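(* Let $(\mathcal{C},K)$ be an abelian ribbon Grothendieck–Verdier category with twist $\theta$, braiding $c$ and dualizing functor $D$, and let $(A,\mu_A,\iota_A)$ be a commutative algebra in $\mathcal{C}$. If $\theta_A^2=\mathrm{id}_A$, then the category $\mathcal{C}_A^{\mathrm{loc}}$ of local left $A$-modules in $\mathcal{C}$ is a braided Grothendieck–Verdier category with dualizing object $(DA,\mu_{DA})$, where $\mu_{DA}:A\otimes DA\to DA$ is the unique morphism such that $$e_A\circ(\mu_{DA}\otimes\mathrm{id}_A)=e_A\circ(\mathrm{id}_{DA}\otimes\mu_A)\circ(c_{A,DA}\otimes\mathrm{id}_A).$$ Moreover, $\mathcal{C}_A^{\mathrm{loc}}$ is a ribbon Grothendieck–Verdier category if $\theta_A=\mathrm{id}_A$.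
   Context: Associativity and unit isomorphisms are suppressed. An object $K$ of a monoidal category $\mathcal{C}$ is dualizing if for every $X\in\mathcal{C}$ the functor $\mathrm{Hom}_{\mathcal{C}}(-\otimes X,K)$ is representable and the resulting contravariant functor $D:\mathcal{C}\to\mathcal{C}$ is an anti-equivalence. Representability means that there are an object $DX$ and a morphism $e_X:DX\otimes X\to K$ such that for every morphism $f:Y\otimes X\to K$ there is a unique $\varphi:Y\to DX$ with $e_X\circ(\varphi\otimes\mathrm{id}_X)=f$. On a morphism $f:X\to Y$, $Df:DY\to DX$ is the unique morphism with $e_X\circ(Df\otimes\mathrm{id}_X)=e_Y\circ(\mathrm{id}_{DY}\otimes f)$. A (braided) Grothendieck–Verdier category is a (braided) monoidal category equipped with a dualizing object; $D$ is its dualizing functor. A twist on a braided monoidal category is a natural isomorphism $\theta:\mathrm{id}_{\mathcal{C}}\to\mathrm{id}_{\mathcal{C}}$ with $\theta_{X\otimes Y}=c_{Y,X}\circ c_{X,Y}\circ(\theta_X\otimes\theta_Y)$ for all $X,Y$. A ribbon Grothendieck–Verdier category is a braided Grothendieck–Verdier category with a twist $\theta$ such that $D\theta_X=\theta_{DX}$ for all $X$. ''Abelian'' means $\mathbb{K}$-linear abelian for a field $\mathbb{K}$, with $\mathbb{K}$-bilinear tensor product. An algebra $(A,\mu_A,\iota_A)$ is commutative if $\mu_A\circ c_{A,A}=\mu_A$. The category $\mathcal{C}_A$ of left $A$-modules $(M,\mu_M)$ is monoidal with unit $A$: $M\otimes_A N$ is the coequalizer, with projection $\pi_{M,N}:M\otimes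 N\to M\otimes_A N$, of $\mu_M\otimes\mathrm{id}_N$ and $(\mathrm{id}_M\otimes\mu_N)\circ(c_{A,M}\otimes\mathrm{id}_N)$ from $A\otimes M\otimes N$ to $M\otimes N$, with $A$-action determined by $\mu_{M\otimes_A N}\circ(\mathrm{id}_A\otimes\pi_{M,N})=\pi_{M,N}\circ(\mu_M\otimes\mathrm{id}_N)$. A module is local if $\mu_M\circ c_{M,A}\circ c_{A,M}=\mu_M$; $\mathcal{C}_A^{\mathrm{loc}}\subseteq\mathcal{C}_A$ is the full subcategory of local modules, a monoidal subcategory which is braided by the braiding $c^A$ with $c^A_{M,N}\circ\pi_{M,N}=\pi_{N,M}\circ c_{M,N}$. *)

(* Defs.v *)
From Stdlib Require Import ProofIrrelevance.
From mathcomp Require Import all_boot ssralg.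

Set Implicit Arguments.
Unset Strict Implicit.
Unset Printing Implicit Defensive.

Import GRing.Theory.

Declare Scope cat_scope.
Delimit Scope cat_scope with cat.
Local Open Scope cat_scope.

Record Category := {
  ob :> Type;
  hom : ob -> ob -> Type;
  idm : forall X, hom X X;
  comp : forall X Y Z, hom Y Z -> hom X Y -> hom X Z;
  comp_id_l : forall X Y (f : hom X Y), comp (idm Y) f = f;
  comp_id_r : forall X Y (f : hom X Y), comp f (idm X) = f;
  comp_assoc : forall W X Y Z (h : hom Y Z) (g : hom X Y) (f : hom W X),
    comp h (comp g f) = comp (comp h g) f
}.

Arguments hom {C} X Y : rename.
Arguments idm {C} X : rename.
Arguments comp {C X Y Z} g f : rename.

Notation "g ∘ f" := (comp g f) (at level 40, left associativity) : cat_scope.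

Record Iso (C : Category) (X Y : C) := {
  fwd :> hom X Y;
  bwd : hom Y X;
  bwd_fwd : bwd ∘ fwd = idm X;
  fwd_bwd : fwd ∘ bwd = idm Y
}.

Definition is_epi (C : Category) (X Y : C) (f : hom X Y) : Prop :=
  forall Z (g h : hom Y Z), g ∘ f = h ∘ f -> g = h.

Definition is_mono (C : Category) (X Y : C) (f : hom X Y) : Prop :=
  forall Z (g h : hom Z X), f ∘ g = f ∘ h -> g = h.

Definition is_coequalizer (C : Category) (X Y Q : C)
    (f g : hom X Y) (q : hom Y Q) : Prop :=
  q ∘ f = q ∘ g /\
  forall Z (h : hom Y Z), h ∘ f = h ∘ g -> exists! u : hom Q Z, u ∘ q = h.

Definition op (C : Category) : Category := {|
  ob := ob C;
  hom := fun X Y => @hom C Y X;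
  idm := fun X => @idm C X;
  comp := fun X Y Z g f => @comp C Z Y X f g;
  comp_id_l := fun X Y f => @comp_id_r C Y X f;
  comp_id_r := fun X Y f => @comp_id_l C Y X f;
  comp_assoc := fun W X Y Z h g f => esym (@comp_assoc C Z Y X W f g h)
|}.

Definition full_subcategory (C : Category) (P : C -> Prop) : Category := {|
  ob := {X : C | P X};
  hom := fun X Y => hom (sval X) (sval Y);
  idm := fun X => idm (sval X);
  comp := fun X Y Z g f => g ∘ f;
  comp_id_l := fun X Y f => comp_id_l f;
  comp_id_r := fun X Y f => comp_id_r f;
  comp_assoc := fun W X Y Z h g f => comp_assoc h g f
|}.

Record Functor (C D : Category) := {
  fob :> C -> D;
  fmap : forall X Y : C, hom X Y -> hom (fob X) (fob Y);
  fmap_id : forall X : C, fmap (idm X) = idm (fob X);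
  fmap_comp : forall (X Y Z : C) (g : hom Y Z) (f : hom X Y),
    fmap (g ∘ f) = fmap g ∘ fmap f
}.

Arguments fmap {C D} F {X Y} f : rename.

Definition functor_id (C : Category) : Functor C C := {|
  fob := fun X => X;
  fmap := fun X Y f => f;
  fmap_id := fun X => erefl;
  fmap_comp := fun X Y Z g f => erefl
|}.

Definition functor_comp (C D E : Category) (G : Functor D E) (F : Functor C D) :
  Functor C E.
Proof.
refine {| fob := fun X => G (F X);
          fmap := fun X Y f => fmap G (fmap F f) |}.
- by move=> X; rewrite !fmap_id.
- by move=> X Y Z g f; rewrite !fmap_comp.
Defined.

Record NatIso (C D : Category) (F G : Functor C D) := {
  nat_iso :> forall X : C, Iso (F X) (G X);
  nat_iso_natural : forall (X Y : C) (f : hom X Y),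
    nat_iso Y ∘ fmap F f = fmap G f ∘ nat_iso X
}.

Definition is_equivalence (C D : Category) (F : Functor C D) : Prop :=
  exists G : Functor D C,
    inhabited (NatIso (functor_comp G F) (functor_id C)) /\
    inhabited (NatIso (functor_comp F G) (functor_id D)).

Record LinearCategory (k : fieldType) := {
  lob : Type;
  lhom : lob -> lob -> lmodType k;
  lid : forall X, lhom X X;
  lcomp : forall X Y Z, lhom Y Z -> lhom X Y -> lhom X Z;
  lcomp_id_l : forall X Y (f : lhom X Y), lcomp (lid Y) f = f;
  lcomp_id_r : forall X Y (f : lhom X Y), lcomp f (lid X) = f;
  lcomp_assoc : forall W X Y Z (h : lhom Y Z) (g : lhom X Y) (f : lhom W X),
    lcomp h (lcomp g f) = lcomp (lcomp h g) f;
  lcomp_linear_l : forall X Y Z (a : k) (g g' : lhom Y Z) (f : lhom X Y),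
    lcomp (a *: g + g')%R f = (a *: lcomp g f + lcomp g' f)%R;
  lcomp_linear_r : forall X Y Z (a : k) (g : lhom Y Z) (f f' : lhom X Y),
    lcomp g (a *: f + f')%R = (a *: lcomp g f + lcomp g f')%R
}.

Definition linear_category (k : fieldType) (C : LinearCategory k) : Category :=
  {| ob := lob C;
     hom := fun X Y => lhom X Y;
     idm := @lid k C;
     comp := @lcomp k C;
     comp_id_l := @lcomp_id_l k C;
     comp_id_r := @lcomp_id_r k C;
     comp_assoc := @lcomp_assoc k C |}.

Coercion linear_category : LinearCategory >-> Category.

Section Abelian.
Context (k : fieldType) (C : LinearCategory k).

Definition hzero (X Y : C) : hom X Y := (0 : lhom X Y)%R.
Definition hadd (X Y : C) (f g : hom X Y) : hom X Y :=
  ((f : lhom X Y) + (g : lhom X Y))%R.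
Definition hscale (X Y : C) (a : k) (f : hom X Y) : hom X Y :=
  (a *: (f : lhom X Y))%R.

Definition is_kernel (X Y N : C) (f : hom X Y) (i : hom N X) : Prop :=
  f ∘ i = hzero N Y /\
  forall Z (h : hom Z X), f ∘ h = hzero Z Y -> exists! u : hom Z N, i ∘ u = h.

Definition is_cokernel (X Y Q : C) (f : hom X Y) (p : hom Y Q) : Prop :=
  p ∘ f = hzero X Q /\
  forall Z (h : hom Y Z), h ∘ f = hzero X Z -> exists! u : hom Q Z, u ∘ p = h.

Definition is_biproduct (X Y P : C) (i : hom X P) (j : hom Y P)
    (p : hom P X) (q : hom P Y) : Prop :=
  [/\ p ∘ i = idm X, q ∘ j = idm Y, p ∘ j = hzero Y X, q ∘ i = hzero X Y
    & hadd (i ∘ p) (j ∘ q) = idm P].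

Record is_abelian : Prop := {
  abelian_zero : exists Z : C, idm Z = hzero Z Z;
  abelian_biproduct : forall X Y : C,
    exists (P : C) (i : hom X P) (j : hom Y P) (p : hom P X) (q : hom P Y),
      is_biproduct i j p q;
  abelian_kernel : forall (X Y : C) (f : hom X Y),
    exists (N : C) (i : hom N X), is_kernel f i;
  abelian_cokernel : forall (X Y : C) (f : hom X Y),
    exists (Q : C) (p : hom Y Q), is_cokernel f p;
  abelian_mono : forall (X Y : C) (f : hom X Y), is_mono f ->
    exists (Z : C) (g : hom Y Z), is_kernel g f;
  abelian_epi : forall (X Y : C) (f : hom X Y), is_epi f ->
    exists (Z : C) (g : hom Z X), is_cokernel g f
}.

End Abelian.

(** Monoidal structures are not assumed to be strict.  The unit object is a
    parameter, so that a structure with a prescribed unit can be spoken of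
    without an equality between objects. *)
Record Monoidal (C : Category) (I : C) := {
  tob : C -> C -> C;
  thom : forall X X' Y Y' : C,
    hom X X' -> hom Y Y' -> hom (tob X Y) (tob X' Y');
  thom_id : forall X Y : C, thom (idm X) (idm Y) = idm (tob X Y);
  thom_comp : forall (X X' X'' Y Y' Y'' : C)
    (f' : hom X' X'') (f : hom X X') (g' : hom Y' Y'') (g : hom Y Y'),
    thom (f' ∘ f) (g' ∘ g) = thom f' g' ∘ thom f g;
  associator : forall X Y Z : C, Iso (tob (tob X Y) Z) (tob X (tob Y Z));
  lunitor : forall X : C, Iso (tob I X) X;
  runitor : forall X : C, Iso (tob X I) X;
  associator_natural : forall (X X' Y Y' Z Z' : C)
    (f : hom X X') (g : hom Y Y') (h : hom Z Z'),
    associator X' Y' Z' ∘ thom (thom f g) h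
      = thom f (thom g h) ∘ associator X Y Z;
  lunitor_natural : forall (X X' : C) (f : hom X X'),
    lunitor X' ∘ thom (idm I) f = f ∘ lunitor X;
  runitor_natural : forall (X X' : C) (f : hom X X'),
    runitor X' ∘ thom f (idm I) = f ∘ runitor X;
  triangle : forall X Y : C,
    thom (idm X) (lunitor Y) ∘ associator X I Y = thom (runitor X) (idm Y);
  pentagon : forall W X Y Z : C,
    associator W X (tob Y Z) ∘ associator (tob W X) Y Z
      = thom (idm W) (associator X Y Z) ∘ associator W (tob X Y) Z
          ∘ thom (associator W X Y) (idm Z)
}.

Arguments tob {C I} T X Y : rename.
Arguments thom {C I} T {X X' Y Y'} f g : rename.
Arguments associator {C I} T X Y Z : rename.
Arguments lunitor {C I} T X : rename.
Arguments runitor {C I} T X : rename.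

Definition is_bilinear_tensor (k : fieldType) (C : LinearCategory k) (I : C)
    (T : Monoidal I) : Prop :=
  (forall (X X' Y Y' : C) (a : k) (f f' : hom X X') (g : hom Y Y'),
     thom T (hadd (hscale a f) f') g
       = hadd (hscale a (thom T f g)) (thom T f' g)) /\
  (forall (X X' Y Y' : C) (a : k) (f : hom X X') (g g' : hom Y Y'),
     thom T f (hadd (hscale a g) g')
       = hadd (hscale a (thom T f g)) (thom T f g')).

Section MonoidalNotions.
Context (C : Category) (I : C) (T : Monoidal I).

Local Notation "X ⊗ Y" := (tob T X Y)
  (at level 35, right associativity) : cat_scope.
Local Notation "f ⊠ g" := (thom T f g)
  (at level 35, right associativity) : cat_scope.
Local Notation α := (associator T).

Record Braiding := {
  braid :> forall X Y : C, Iso (X ⊗ Y) (Y ⊗ X);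
  braid_natural : forall (X X' Y Y' : C) (f : hom X X') (g : hom Y Y'),
    braid X' Y' ∘ (f ⊠ g) = (g ⊠ f) ∘ braid X Y;
  hexagon_r : forall X Y Z : C,
    α Y Z X ∘ braid X (Y ⊗ Z) ∘ α X Y Z
      = (idm Y ⊠ braid X Z) ∘ α Y X Z ∘ (braid X Y ⊠ idm Z);
  hexagon_l : forall X Y Z : C,
    bwd (α Z X Y) ∘ braid (X ⊗ Y) Z ∘ bwd (α X Y Z)
      = (braid X Z ⊠ idm Y) ∘ bwd (α X Z Y) ∘ (idm X ⊠ braid Y Z)
}.

Record Twist (c : Braiding) := {
  twist :> forall X : C, Iso X X;
  twist_natural : forall (X Y : C) (f : hom X Y),
    twist Y ∘ f = f ∘ twist X;
  twist_tensor : forall X Y : C,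
    (twist (X ⊗ Y) : hom _ _) = c Y X ∘ c X Y ∘ (twist X ⊠ twist Y)
}.

(** A choice of representing objects for the functors Hom(- ⊗ X, K);
    [curry f] is the unique φ with e_X ∘ (φ ⊗ id) = f. *)
Record Duals (K : C) := {
  dual : C -> C;
  ev : forall X : C, hom (dual X ⊗ X) K;
  curry : forall X Y : C, hom (Y ⊗ X) K -> hom Y (dual X);
  ev_curry : forall (X Y : C) (f : hom (Y ⊗ X) K),
    ev X ∘ (curry f ⊠ idm X) = f;
  curry_unique : forall (X Y : C) (f : hom (Y ⊗ X) K) (φ : hom Y (dual X)),
    ev X ∘ (φ ⊠ idm X) = f -> φ = curry f
}.

Definition dual_map (K : C) (D : Duals K) (X Y : C) (f : hom X Y) :
    hom (dual D Y) (dual D X) :=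
  curry D (ev D Y ∘ (idm (dual D Y) ⊠ f)).

Lemma dual_map_spec (K : C) (D : Duals K) (X Y : C) (f : hom X Y) :
  ev D X ∘ (dual_map D f ⊠ idm X) = ev D Y ∘ (idm (dual D Y) ⊠ f).
Proof. exact: ev_curry. Qed.

Lemma dual_map_id (K : C) (D : Duals K) (X : C) :
  dual_map D (idm X) = idm (dual D X).
Proof. by symmetry; apply: curry_unique. Qed.

Lemma dual_map_comp (K : C) (D : Duals K) (X Y Z : C)
    (g : hom Y Z) (f : hom X Y) :
  dual_map D (g ∘ f) = dual_map D f ∘ dual_map D g.
Proof.
symmetry; apply: curry_unique.
rewrite -{1}(comp_id_l (idm X)) thom_comp comp_assoc dual_map_spec.
rewrite -comp_assoc -thom_comp comp_id_l comp_id_r.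
rewrite -[dual_map D g]comp_id_r -[f]comp_id_l thom_comp comp_assoc.
rewrite dual_map_spec -comp_assoc -thom_comp.
by rewrite !comp_id_l.
Qed.

Definition dualizing_functor (K : C) (D : Duals K) : Functor (op C) C :=
  @Build_Functor (op C) C (dual D)
    (fun (X Y : op C) (f : @hom (op C) X Y) => dual_map D f)
    (dual_map_id D)
    (fun X Y Z g f => dual_map_comp D f g).

Record GrothendieckVerdier (K : C) := {
  gv_duals :> Duals K;
  gv_equivalence : is_equivalence (dualizing_functor gv_duals)
}.

Definition is_ribbon (K : C) (D : GrothendieckVerdier K) (c : Braiding)
    (θ : Twist c) : Prop :=
  forall X : C, dual_map D (θ X) = θ (dual D X).

Record Algebra := {
  alg :> C;
  mul : hom (alg ⊗ alg) alg;
  one : hom I alg;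
  mul_assoc : mul ∘ (mul ⊠ idm alg) = mul ∘ (idm alg ⊠ mul) ∘ α alg alg alg;
  mul_one_l : mul ∘ (one ⊠ idm alg) = lunitor T alg;
  mul_one_r : mul ∘ (idm alg ⊠ one) = runitor T alg
}.

Definition is_commutative (c : Braiding) (A : Algebra) : Prop :=
  mul A ∘ c A A = mul A.

Section Modules.
Context (A : Algebra).

Record is_module (M : C) (a : hom (A ⊗ M) M) : Prop := {
  module_assoc : a ∘ (mul A ⊠ idm M) = a ∘ (idm A ⊠ a) ∘ α A A M;
  module_unit : a ∘ (one A ⊠ idm M) = lunitor T M
}.

Record Module := {
  carrier :> C;
  act : hom (A ⊗ carrier) carrier;
  act_module : is_module act
}.

Record ModuleHom (M N : Module) := {
  mhom :> hom M N;
  mhom_act : mhom ∘ act M = act N ∘ (idm A ⊠ mhom)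
}.

Lemma mhom_inj (M N : Module) (f g : ModuleHom M N) :
  mhom f = mhom g -> f = g.
Proof.
case: f g => [f hf] [g hg] /= e; subst g.
by rewrite (proof_irrelevance _ hf hg).
Qed.

Lemma mhom_id_subproof (M : Module) :
  idm M ∘ act M = act M ∘ (idm A ⊠ idm M).
Proof. by rewrite thom_id comp_id_l comp_id_r. Qed.

Lemma mhom_comp_subproof (M N P : Module)
    (g : ModuleHom N P) (f : ModuleHom M N) :
  (g ∘ f) ∘ act M = act P ∘ (idm A ⊠ (g ∘ f)).
Proof.
rewrite -comp_assoc mhom_act comp_assoc mhom_act -comp_assoc.
by rewrite -thom_comp comp_id_l.
Qed.

Definition mhom_id (M : Module) : ModuleHom M M :=
  Build_ModuleHom (mhom_id_subproof M).

Definition mhom_comp (M N P : Module)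
    (g : ModuleHom N P) (f : ModuleHom M N) : ModuleHom M P :=
  Build_ModuleHom (mhom_comp_subproof g f).

Definition module_category : Category.
Proof.
refine {| ob := Module; hom := ModuleHom; idm := mhom_id; comp := mhom_comp |}.
- by move=> M N f; apply: mhom_inj; apply: comp_id_l.
- by move=> M N f; apply: mhom_inj; apply: comp_id_r.
- by move=> M N P Q h g f; apply: mhom_inj; apply: comp_assoc.
Defined.

Lemma regular_subproof : is_module (mul A).
Proof. by split; [exact: mul_assoc | exact: mul_one_l]. Qed.

Definition regular : Module := Build_Module regular_subproof.

Context (c : Braiding).

Definition is_local (M : Module) : Prop :=
  act M ∘ c M A ∘ c A M = act M.

Definition local_modules : Category :=
  @full_subcategory module_category is_local.

Definition underlying (M : local_modules) : Module := sval M.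

Definition underlying_hom (M N : local_modules) (f : hom M N) :
  hom (underlying M) (underlying N) := mhom f.

Lemma regular_local (hA : is_commutative c A) : is_local regular.
Proof. by rewrite /is_local /= hA hA. Qed.

Definition regular_local_module (hA : is_commutative c A) : local_modules :=
  exist _ regular (regular_local hA).

Definition dual_act (K : C) (D : Duals K) : hom (A ⊗ dual D A) (dual D A) :=
  curry D (ev D A ∘ (idm (dual D A) ⊠ mul A) ∘ α (dual D A) A A
             ∘ (c A (dual D A) ⊠ idm A)).

Lemma dual_act_spec (K : C) (D : Duals K) :
  unique
    (fun a : hom (A ⊗ dual D A) (dual D A) =>
       ev D A ∘ (a ⊠ idm A)
         = ev D A ∘ (idm (dual D A) ⊠ mul A) ∘ α (dual D A) A A
             ∘ (c A (dual D A) ⊠ idm A))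
    (dual_act D).
Proof.
split; first exact: ev_curry.
by move=> a ha; symmetry; apply: curry_unique.
Qed.

End Modules.

End MonoidalNotions.

Section RelativeTensorProduct.
Context (C : Category) (I : C) (T : Monoidal I) (c : Braiding T).
Context (A : Algebra T) (hA : is_commutative c A).

Local Notation "X ⊗ Y" := (tob T X Y)
  (at level 35, right associativity) : cat_scope.
Local Notation "f ⊠ g" := (thom T f g)
  (at level 35, right associativity) : cat_scope.
Local Notation α := (associator T).
Local Notation Loc := (local_modules A c).
Local Notation "⌊ M ⌋" := (underlying M) (format "⌊ M ⌋") : cat_scope.
Local Notation "⟦ f ⟧" := (underlying_hom f) (format "⟦ f ⟧") : cat_scope.

(** The braided monoidal structure of the category of local modules, for a
    choice of relative tensor products M ⊗_A N and of projections
    [rel_proj M N] : M ⊗ N -> M ⊗_A N.  The equations determine all the other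
    data from this choice, since the projections and their tensor products with
    objects are epimorphisms when ⊗ preserves coequalizers.  In [rel_runitor],
    c_{M,A} makes M a right module; it may be replaced by the inverse of
    c_{A,M} because M is local. *)
Record RelativeTensor := {
  rel_monoidal :> @Monoidal Loc (regular_local_module hA);
  rel_braiding : Braiding rel_monoidal;
  rel_proj : forall M N : Loc,
    hom (⌊M⌋ ⊗ ⌊N⌋) ⌊tob rel_monoidal M N⌋;
  rel_coequalizer : forall M N : Loc,
    is_coequalizer
      (act ⌊M⌋ ⊠ idm ⌊N⌋)
      ((idm ⌊M⌋ ⊠ act ⌊N⌋) ∘ α ⌊M⌋ A ⌊N⌋ ∘ (c A ⌊M⌋ ⊠ idm ⌊N⌋))
      (rel_proj M N);
  rel_act : forall M N : Loc,
    act ⌊tob rel_monoidal M N⌋ ∘ (idm A ⊠ rel_proj M N)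
      = rel_proj M N ∘ (act ⌊M⌋ ⊠ idm ⌊N⌋) ∘ bwd (α A ⌊M⌋ ⌊N⌋);
  rel_hom : forall (M M' N N' : Loc) (f : hom M M') (g : hom N N'),
    ⟦thom rel_monoidal f g⟧ ∘ rel_proj M N
      = rel_proj M' N' ∘ (⟦f⟧ ⊠ ⟦g⟧);
  rel_associator : forall M N P : Loc,
    ⟦associator rel_monoidal M N P⟧
        ∘ rel_proj (tob rel_monoidal M N) P ∘ (rel_proj M N ⊠ idm ⌊P⌋)
      = rel_proj M (tob rel_monoidal N P) ∘ (idm ⌊M⌋ ⊠ rel_proj N P)
          ∘ α ⌊M⌋ ⌊N⌋ ⌊P⌋;
  rel_lunitor : forall M : Loc,
    ⟦lunitor rel_monoidal M⟧ ∘ rel_proj (regular_local_module hA) M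
      = act ⌊M⌋;
  rel_runitor : forall M : Loc,
    ⟦runitor rel_monoidal M⟧ ∘ rel_proj M (regular_local_module hA)
      = act ⌊M⌋ ∘ c ⌊M⌋ A;
  rel_braid : forall M N : Loc,
    ⟦rel_braiding M N⟧ ∘ rel_proj M N = rel_proj N M ∘ c ⌊M⌋ ⌊N⌋
}.

End RelativeTensorProduct.

(* Main.v *)
From mathcomp Require Import all_boot ssralg.
Require Import Defs.
From Stdlib Require Import IndefiniteDescription.

(** Write D for the dualizing functor, e for the evaluations and L for the
    category of local A-modules.

    The tensor product of L.  The pairing e_X ∘ c_{X,DX} identifies X with
    D(DX), because D is full and faithful ([bidual]).  Hence every functor
    Hom(- ⊗ W, Z) is representable ([internal_hom]), so ⊗ preserves
    coequalizers in each variable ([gv_tensor_coequalizer]).  The coequalizers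
    defining M ⊗_A N exist in an abelian category, they stay coequalizers after
    tensoring, and all structure on them is induced from the structure of C:
    a morphism out of M ⊗_A N is an A-balanced morphism out of M ⊗ N
    ([relative_tensor_exists]).

    Dual modules.  The transpose of the action of M through the braiding makes
    DM a module, and e_M is balanced.  Conversely a morphism N -> DM is linear
    if and only if the pairing N ⊗ M -> K it represents is balanced
    ([linear_pairing]).  If M is local, then θ_M ∘ μ_M = μ_M ∘ (θ_A ⊗ θ_M);
    dualizing this with Dθ = θ and comparing it with the twist axiom for
    A ⊗ DM shows that the double braiding changes the action of A on DM exactly
    by the inverse of θ_A², so that DM is local when θ_A² = id ([dual_action_local]).

    Representability.  The module DA is cofree: linear maps X -> DA correspond
    to morphisms X -> K ([counit_inj], [counit_full]).  Therefore linear maps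
    N ⊗_A M -> DA correspond to morphisms N ⊗_A M -> K, that is, to balanced
    pairings N ⊗ M -> K, that is, to linear maps N -> DM.  So DM, with an
    evaluation induced by e_M, is the dual of M in L ([local_duals]).

    Anti-equivalence and twist.  The isomorphism M -> D(DM) is linear when M is
    local, since the two actions differ by the double braiding of A and M
    ([bidual_linear]); so the dualizing functor of L is its own quasi-inverse.
    If θ_A = id, then θ_M is linear, and θ restricts to a ribbon twist on L.

    Associators are kept under control by writing every morphism on right-nested
    tensor products: f : X ⊗ Y -> Z acts on X ⊗ (Y ⊗ W) as f ▸ W, and the
    braiding acts on X ⊗ (Y ⊗ W) as [swap].  In this form the pentagon is
    absorbed, and the axioms for modules, braidings and twists become equations
    without associators, as in a strict category. *)

Set Implicit Arguments.
Unset Strict Implicit.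
Unset Printing Implicit Defensive.

Local Open Scope cat_scope.

(** * Composition and coequalizers *)

Section Composition.
Context (C : Category).

(** Composites are kept in the form h ∘ (g ∘ (f ∘ ...)); this turns an equation
    between composites into a rewriting rule that applies inside such a chain. *)
Lemma reassoc (W X Y Z : C) (g : hom Y Z) (f : hom X Y) (h : hom X Z) :
  g ∘ f = h -> forall k : hom W X, g ∘ (f ∘ k) = h ∘ k.
Proof. by move=> <- k; rewrite comp_assoc. Qed.

Lemma bwdK (X Y Z : C) (u : Iso X Y) (k : hom Z X) : bwd u ∘ (u ∘ k) = k.
Proof. by rewrite comp_assoc bwd_fwd comp_id_l. Qed.

Lemma fwdK (X Y Z : C) (u : Iso X Y) (k : hom Z Y) : u ∘ (bwd u ∘ k) = k.
Proof. by rewrite comp_assoc fwd_bwd comp_id_l. Qed.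

Lemma iso_epi (X Y : C) (u : Iso X Y) : is_epi u.
Proof.
by move=> Z g h e; rewrite -[g]comp_id_r -[h]comp_id_r -(fwd_bwd u) !comp_assoc e.
Qed.

Lemma iso_mono (X Y : C) (u : Iso X Y) : is_mono u.
Proof. by move=> Z g h e; rewrite -[g](bwdK u) -[h](bwdK u) e. Qed.

Definition iso_id (X : C) : Iso X X :=
  Build_Iso (comp_id_l (idm X)) (comp_id_l (idm X)).

Definition iso_inv (X Y : C) (u : Iso X Y) : Iso Y X :=
  Build_Iso (fwd_bwd u) (bwd_fwd u).

Definition iso_comp (X Y Z : C) (v : Iso Y Z) (u : Iso X Y) : Iso X Z.
Proof.
exists (v ∘ u) (bwd u ∘ bwd v).
- by rewrite -comp_assoc bwdK bwd_fwd.
- by rewrite -comp_assoc fwdK fwd_bwd.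
Defined.

Lemma epi_comp (X Y Z : C) (g : hom Y Z) (f : hom X Y) :
  is_epi g -> is_epi f -> is_epi (g ∘ f).
Proof. by move=> eg ef W u v e; apply: eg; apply: ef; rewrite -!comp_assoc. Qed.

Lemma coequalizer_epi (X Y Q : C) (f g : hom X Y) (q : hom Y Q) :
  is_coequalizer f g q -> is_epi q.
Proof.
case=> e U Z u v euv; have [|w [_ uw]] := U Z (u ∘ q).
  by rewrite -!comp_assoc e.
by rewrite -(uw u) // -(uw v).
Qed.

(** Universal properties are stated with existence in Prop, but the structure
    morphisms of the relative tensor product are data; hence the choice. *)
Definition descend (X Y Q Z : C) (f g : hom X Y) (q : hom Y Q) (h : hom Y Z)
    (hq : is_coequalizer f g q) (hh : h ∘ f = h ∘ g) : {u : hom Q Z | u ∘ q = h}.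
Proof.
apply: constructive_indefinite_description.
by have [u [e _]] := hq.2 Z h hh; exists u.
Qed.

Lemma coequalizer_iso (X Y Q X' Y' Q' : C) (f g : hom X Y) (q : hom Y Q)
    (f' g' : hom X' Y') (q' : hom Y' Q')
    (u : Iso X X') (v : Iso Y Y') (w : Iso Q Q') :
  f' ∘ u = v ∘ f -> g' ∘ u = v ∘ g -> q' ∘ v = w ∘ q ->
  is_coequalizer f g q -> is_coequalizer f' g' q'.
Proof.
move=> ef eg eq cq; have [e U] := cq.
have epiq := coequalizer_epi cq.
split.
  apply: (iso_epi (u := u)).
  by rewrite -!comp_assoc ef eg !(comp_assoc q') eq -!comp_assoc e.
move=> Z h eh; have [|r [er ur]] := U Z (h ∘ v).
  by rewrite -!comp_assoc -ef -eg !comp_assoc eh.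
exists (r ∘ bwd w); split.
  by apply: (iso_epi (u := v)); rewrite -!comp_assoc eq bwdK er.
move=> s es; apply: (iso_epi (u := w)); rewrite -comp_assoc bwd_fwd comp_id_r.
by apply: ur; rewrite -es -!comp_assoc eq.
Qed.

End Composition.

(** * Right-nested whiskering *)

Section Coherence.
Context (C : Category) (I : C) (T : Monoidal I).

Local Notation "X ⊗ Y" := (tob T X Y)
  (at level 35, right associativity) : cat_scope.
Local Notation "f ⊠ g" := (thom T f g)
  (at level 35, right associativity) : cat_scope.
Local Notation α := (associator T).

Definition lwhisker (X Y Z : C) (g : hom Y Z) : hom (X ⊗ Y) (X ⊗ Z) :=
  idm X ⊠ g.
Definition rwhisker (X Y : C) (f : hom X Y) (W : C) : hom (X ⊗ W) (Y ⊗ W) :=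
  f ⊠ idm W.
(** [f ▸ W] is [f] applied to the first two factors of X ⊗ (Y ⊗ W).  It is
    locked because rewriting with rules on composites must not look inside. *)
Definition bwhisker (X Y Z : C) (f : hom (X ⊗ Y) Z) (W : C) :
  hom (X ⊗ Y ⊗ W) (Z ⊗ W) := locked ((f ⊠ idm W) ∘ bwd (α X Y W)).

Local Notation "X ◁ g" := (lwhisker X g) (at level 34, right associativity).
Local Notation "f ▷ W" := (rwhisker f W) (at level 33, left associativity).
Local Notation "f ▸ W" := (bwhisker f W) (at level 33, left associativity).

Definition tensor_preserves_coequalizers : Prop :=
  forall (W X Y Q : C) (f g : hom X Y) (q : hom Y Q),
    is_coequalizer f g q -> is_coequalizer (f ▷ W) (g ▷ W) (q ▷ W).

Lemma thomE (X X' Y Y' : C) (f : hom X X') (g : hom Y Y') :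
  f ⊠ g = (f ▷ Y') ∘ (X ◁ g).
Proof. by rewrite /rwhisker /lwhisker -thom_comp comp_id_l comp_id_r. Qed.

Lemma whisker_exchange (X X' Y Y' : C) (f : hom X X') (g : hom Y Y') :
  (f ▷ Y') ∘ (X ◁ g) = (X' ◁ g) ∘ (f ▷ Y).
Proof. by rewrite /rwhisker /lwhisker -!thom_comp !comp_id_l !comp_id_r. Qed.

Lemma lwhisker_id (X Y : C) : X ◁ idm Y = idm (X ⊗ Y).
Proof. exact: thom_id. Qed.

Lemma rwhisker_id (X Y : C) : idm X ▷ Y = idm (X ⊗ Y).
Proof. exact: thom_id. Qed.

Lemma lwhisker_comp (X Y Y' Y'' : C) (g : hom Y' Y'') (f : hom Y Y') :
  X ◁ (g ∘ f) = (X ◁ g) ∘ (X ◁ f).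
Proof. by rewrite /lwhisker -thom_comp comp_id_l. Qed.

Lemma rwhisker_comp (W Y Y' Y'' : C) (g : hom Y' Y'') (f : hom Y Y') :
  (g ∘ f) ▷ W = (g ▷ W) ∘ (f ▷ W).
Proof. by rewrite /rwhisker -thom_comp comp_id_l. Qed.

Definition lwhisker_iso (X Y Z : C) (u : Iso Y Z) : Iso (X ⊗ Y) (X ⊗ Z).
Proof.
exists (X ◁ u) (X ◁ bwd u).
- by rewrite -lwhisker_comp bwd_fwd lwhisker_id.
- by rewrite -lwhisker_comp fwd_bwd lwhisker_id.
Defined.

Definition rwhisker_iso (X Y W : C) (u : Iso X Y) : Iso (X ⊗ W) (Y ⊗ W).
Proof.
exists (u ▷ W) (bwd u ▷ W).
- by rewrite -rwhisker_comp bwd_fwd rwhisker_id.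
- by rewrite -rwhisker_comp fwd_bwd rwhisker_id.
Defined.

Lemma lwhisker_eq (V X Y Z : C) (g : hom Y Z) (f : hom X Y) (h : hom X Z) :
  g ∘ f = h -> (V ◁ g) ∘ (V ◁ f) = V ◁ h.
Proof. by rewrite -lwhisker_comp => ->. Qed.

Lemma rwhisker_eq (V X Y Z : C) (g : hom Y Z) (f : hom X Y) (h : hom X Z) :
  g ∘ f = h -> (g ▷ V) ∘ (f ▷ V) = h ▷ V.
Proof. by rewrite -rwhisker_comp => ->. Qed.

Lemma associator_rr (X X' Y Z : C) (f : hom X X') :
  α X' Y Z ∘ ((f ▷ Y) ▷ Z) = (f ▷ (Y ⊗ Z)) ∘ α X Y Z.
Proof. by rewrite associator_natural thom_id. Qed.

Lemma associator_lr (X Y Y' Z : C) (f : hom Y Y') :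
  α X Y' Z ∘ ((X ◁ f) ▷ Z) = (X ◁ (f ▷ Z)) ∘ α X Y Z.
Proof. exact: associator_natural. Qed.

Lemma associator_ll (X Y Z Z' : C) (f : hom Z Z') :
  α X Y Z' ∘ ((X ⊗ Y) ◁ f) = (X ◁ (Y ◁ f)) ∘ α X Y Z.
Proof. by rewrite -associator_natural thom_id. Qed.

Lemma bwhiskerE (X Y Z W : C) (f : hom (X ⊗ Y) Z) :
  f ▷ W = (f ▸ W) ∘ α X Y W.
Proof. by rewrite /bwhisker -lock -comp_assoc bwd_fwd comp_id_r. Qed.

Lemma bwhisker_natural (X Y Z W W' : C) (f : hom (X ⊗ Y) Z) (g : hom W W') :
  (f ▸ W') ∘ (X ◁ (Y ◁ g)) = (Z ◁ g) ∘ (f ▸ W).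
Proof.
apply: (iso_epi (u := α X Y W)); rewrite -!comp_assoc -bwhiskerE.
by rewrite -associator_ll comp_assoc -bwhiskerE whisker_exchange.
Qed.

Lemma bwhisker_post (X Y Z Z' W : C) (g : hom Z Z') (f : hom (X ⊗ Y) Z) :
  (g ∘ f) ▸ W = (g ▷ W) ∘ (f ▸ W).
Proof.
apply: (iso_epi (u := α X Y W)).
by rewrite -!comp_assoc -!bwhiskerE rwhisker_comp.
Qed.

Lemma bwhisker_pre_l (X X' Y Z W : C) (f : hom (X' ⊗ Y) Z) (g : hom X X') :
  (f ∘ (g ▷ Y)) ▸ W = (f ▸ W) ∘ (g ▷ (Y ⊗ W)).
Proof.
apply: (iso_epi (u := α X Y W)).
by rewrite -!comp_assoc -associator_rr comp_assoc -!bwhiskerE rwhisker_comp.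
Qed.

Lemma bwhisker_pre_r (X Y Y' Z W : C) (f : hom (X ⊗ Y') Z) (g : hom Y Y') :
  (f ∘ (X ◁ g)) ▸ W = (f ▸ W) ∘ (X ◁ (g ▷ W)).
Proof.
apply: (iso_epi (u := α X Y W)).
by rewrite -!comp_assoc -associator_lr comp_assoc -!bwhiskerE rwhisker_comp.
Qed.

Lemma pentagon_whisker (W X Y Z : C) :
  (W ◁ α X Y Z) ∘ (α W (X ⊗ Y) Z ∘ (α W X Y ▷ Z)) = α W X (Y ⊗ Z) ∘ α (W ⊗ X) Y Z.
Proof. by rewrite pentagon -comp_assoc. Qed.

(** The analogue of [f ▸ W] for three factors.  The lemmas below compute it on
    composites; applying it to both sides of an equation between morphisms on
    X ⊗ (Y ⊗ Z) yields the same equation with a further factor W on the right. *)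
Definition twhisker (X Y Z R : C) (h : hom (X ⊗ Y ⊗ Z) R) (W : C) :
    hom (X ⊗ Y ⊗ Z ⊗ W) (R ⊗ W) :=
  locked ((h ▸ W) ∘ (X ◁ bwd (α Y Z W))).

(** Whiskering in two steps agrees with whiskering by the tensor product: this
    is the pentagon. *)
Lemma bwhisker_bwhisker (X Y V Z W : C) (l : hom (X ⊗ Y) V) :
  α V Z W ∘ ((l ▸ Z) ▸ W) = (l ▸ (Z ⊗ W)) ∘ (X ◁ α Y Z W).
Proof.
apply: (iso_epi (u := α X (Y ⊗ Z) W)).
apply: (iso_epi (u := rwhisker_iso W (α X Y Z))); rewrite /=.
rewrite -!comp_assoc pentagon_whisker.
rewrite (comp_assoc (_ ▸ W)) -bwhiskerE -rwhisker_comp -bwhiskerE.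
by rewrite associator_rr (comp_assoc (_ ▸ _)) -bwhiskerE.
Qed.

Lemma twhisker_l (X Y Z V R W : C) (f : hom (V ⊗ Z) R) (l : hom (X ⊗ Y) V) :
  twhisker (f ∘ (l ▸ Z)) W = (f ▸ W) ∘ (l ▸ (Z ⊗ W)).
Proof.
apply: (iso_epi (u := lwhisker_iso X (α Y Z W))); rewrite /twhisker -!lock /=.
rewrite -!comp_assoc -lwhisker_comp bwd_fwd lwhisker_id comp_id_r.
by rewrite -bwhisker_bwhisker comp_assoc -bwhiskerE bwhisker_post.
Qed.

Lemma twhisker_r (X Y Z V R W : C) (f : hom (X ⊗ V) R) (g : hom (Y ⊗ Z) V) :
  twhisker (f ∘ (X ◁ g)) W = (f ▸ W) ∘ (X ◁ (g ▸ W)).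
Proof.
rewrite /twhisker -!lock bwhisker_pre_r -comp_assoc -lwhisker_comp bwhiskerE.
by rewrite -comp_assoc fwd_bwd comp_id_r.
Qed.

(** In right-nested form the associator acts as the identity. *)
Lemma twhisker_associator (X Y Z R W : C) (h : hom (X ⊗ Y ⊗ Z) R) :
  (h ∘ α X Y Z) ▸ W = twhisker h W ∘ α X Y (Z ⊗ W).
Proof.
apply: (iso_epi (u := α (X ⊗ Y) Z W)).
rewrite -bwhiskerE -comp_assoc -pentagon_whisker /twhisker -!lock -!comp_assoc.
rewrite (reassoc (h := idm _)); last first.
  by rewrite -/(lwhisker _ _) -lwhisker_comp bwd_fwd lwhisker_id.
by rewrite comp_id_l comp_assoc -bwhiskerE -rwhisker_comp.
Qed.

(** Kelly's argument: the equation holds after tensoring with the unit on the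
    left, by the triangle and the pentagon, and that functor is faithful. *)
Lemma lunitor_tensor (X Y : C) :
  lunitor T (X ⊗ Y) ∘ α I X Y = lunitor T X ▷ Y.
Proof.
have faith (U V : C) (f g : hom U V) : I ◁ f = I ◁ g -> f = g.
  move=> e; apply: (iso_epi (u := lunitor T U)).
  by rewrite -!lunitor_natural -!/(lwhisker _ _) e.
apply: faith; rewrite lwhisker_comp.
apply: (iso_epi (u := α I (I ⊗ X) Y)).
apply: (iso_epi (u := rwhisker_iso Y (α I I X))); rewrite /=.
rewrite -!comp_assoc pentagon_whisker comp_assoc triangle.
rewrite -/(rwhisker _ _) -associator_rr.
rewrite comp_assoc -associator_lr -comp_assoc; congr (_ ∘ _).
by rewrite -rwhisker_comp triangle.
Qed.

End Coherence.

(** * Braidings in right-nested form *)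

Section BraidedCoherence.
Context (C : Category) (I : C) (T : Monoidal I) (c : Braiding T).

Local Notation "X ⊗ Y" := (tob T X Y)
  (at level 35, right associativity) : cat_scope.
Local Notation "f ⊠ g" := (thom T f g)
  (at level 35, right associativity) : cat_scope.
Local Notation "X ◁ g" := (lwhisker T X g) (at level 34, right associativity).
Local Notation "f ▷ W" := (rwhisker T f W) (at level 33, left associativity).
Local Notation "f ▸ W" := (bwhisker f W) (at level 33, left associativity).
Local Notation α := (associator T).

Lemma thom_rwhisker (X X' X'' Y Y' : C) (f : hom X' X'') (g : hom Y Y') (h : hom X X') :
  (f ⊠ g) ∘ (h ▷ Y) = (f ∘ h) ⊠ g.
Proof. by rewrite -thom_comp comp_id_r. Qed.

Lemma thom_lwhisker (X X' Y Y' Y'' : C) (f : hom X X') (g : hom Y' Y'') (h : hom Y Y') :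
  (f ⊠ g) ∘ (X ◁ h) = f ⊠ (g ∘ h).
Proof. by rewrite -thom_comp comp_id_r. Qed.

Lemma rwhisker_thom (X X' X'' Y Y' : C) (f : hom X' X'') (g : hom Y Y') (h : hom X X') :
  (f ▷ Y') ∘ (h ⊠ g) = (f ∘ h) ⊠ g.
Proof. by rewrite -thom_comp comp_id_l. Qed.

Lemma lwhisker_thom (X X' Y Y' Y'' : C) (f : hom X X') (g : hom Y' Y'') (h : hom Y Y') :
  (X' ◁ g) ∘ (f ⊠ h) = f ⊠ (g ∘ h).
Proof. by rewrite -thom_comp comp_id_l. Qed.

Lemma rwhisker_twhisker (X Y Z R W : C) (h : hom (X ⊗ Y ⊗ Z) R) :
  h ▷ W = twhisker h W ∘ ((X ◁ α Y Z W) ∘ α X (Y ⊗ Z) W).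
Proof.
rewrite /twhisker -!lock -comp_assoc (reassoc (lwhisker_eq T X (bwd_fwd _))).
by rewrite lwhisker_id comp_id_l -bwhiskerE.
Qed.

Lemma associator_twhisker_r (X Y Z V W : C) (g : hom (Y ⊗ Z) V) :
  α X V W ∘ twhisker (X ◁ g) W = X ◁ (g ▸ W).
Proof.
apply: (iso_epi (u := iso_comp (lwhisker_iso T X (α Y Z W)) (α X (Y ⊗ Z) W))).
rewrite /= -comp_assoc -rwhisker_twhisker associator_lr comp_assoc.
by rewrite -lwhisker_comp -bwhiskerE.
Qed.

Lemma associator_twhisker_l (X Y Z V W : C) (f : hom (X ⊗ Y) V) :
  α V Z W ∘ twhisker (f ▸ Z) W = f ▸ (Z ⊗ W).
Proof.
rewrite /twhisker -!lock comp_assoc bwhisker_bwhisker -comp_assoc.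
by rewrite -lwhisker_comp fwd_bwd lwhisker_id comp_id_r.
Qed.

(** Unlike in [twhisker_r], the target of [l] is itself a tensor product, and the
    associator brings the result back to right-nested form. *)
Lemma twhisker_pre_r (X Y Z Y' Z' R W : C) (h : hom (X ⊗ Y ⊗ Z) R)
    (l : hom (Y' ⊗ Z') (Y ⊗ Z)) :
  twhisker (h ∘ (X ◁ l)) W = twhisker h W ∘ (X ◁ (α Y Z W ∘ (l ▸ W))).
Proof.
by rewrite twhisker_r /twhisker -!lock -comp_assoc -lwhisker_comp bwdK.
Qed.

(** Locked for the same reason as [bwhisker]. *)
Definition swap (X Y W : C) : Iso (X ⊗ Y ⊗ W) (Y ⊗ X ⊗ W) :=
  locked (iso_comp (α Y X W)
            (iso_comp (rwhisker_iso T W (c X Y)) (iso_inv (α X Y W)))).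

Lemma swapE (X Y W : C) : (swap X Y W : hom _ _) = α Y X W ∘ (c X Y ▸ W).
Proof. by rewrite /swap /bwhisker -!lock. Qed.

Lemma braid_natural_l (X X' Y : C) (f : hom X X') :
  c X' Y ∘ (f ▷ Y) = (Y ◁ f) ∘ c X Y.
Proof. exact: braid_natural. Qed.

Lemma braid_natural_r (X Y Y' : C) (f : hom Y Y') :
  c X Y' ∘ (X ◁ f) = (f ▷ X) ∘ c X Y.
Proof. exact: braid_natural. Qed.

Lemma swap_natural (X Y W W' : C) (g : hom W W') :
  swap X Y W' ∘ (X ◁ (Y ◁ g)) = (Y ◁ (X ◁ g)) ∘ swap X Y W.
Proof.
by rewrite !swapE -comp_assoc bwhisker_natural !comp_assoc associator_ll.
Qed.

Lemma swap_natural_l (X X' Y W : C) (f : hom X X') :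
  swap X' Y W ∘ (f ▷ (Y ⊗ W)) = (Y ◁ (f ▷ W)) ∘ swap X Y W.
Proof.
rewrite !swapE -comp_assoc -bwhisker_pre_l braid_natural_l bwhisker_post.
by rewrite !comp_assoc associator_lr.
Qed.

Lemma swap_natural_r (X Y Y' W : C) (f : hom Y Y') :
  swap X Y' W ∘ (X ◁ (f ▷ W)) = (f ▷ (X ⊗ W)) ∘ swap X Y W.
Proof.
rewrite !swapE -comp_assoc -bwhisker_pre_r braid_natural_r bwhisker_post.
by rewrite !comp_assoc associator_rr.
Qed.

(** Naturality of the braiding along a morphism with two inputs; by the
    hexagon, the object A passes the two inputs one after the other. *)
Lemma braid_bwhisker_r (A X Y Z : C) (f : hom (X ⊗ Y) Z) :
  c A Z ∘ (A ◁ f) = (f ▸ A) ∘ ((X ◁ c A Y) ∘ swap A X Y).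
Proof.
rewrite braid_natural_r bwhiskerE -comp_assoc; congr (_ ∘ _).
apply: (iso_epi (u := α A X Y)).
by rewrite hexagon_r swapE -!comp_assoc -bwhiskerE.
Qed.

Lemma braid_bwhisker_l (A X Y Z : C) (f : hom (X ⊗ Y) Z) :
  c Z A ∘ (f ▸ A) = (A ◁ f) ∘ (swap X A Y ∘ (X ◁ c Y A)).
Proof.
apply: (iso_epi (u := α X Y A)).
rewrite -!comp_assoc -bwhiskerE braid_natural_l; congr (_ ∘ _).
apply: (iso_mono (u := iso_inv (α A X Y))).
apply: (iso_epi (u := iso_inv (α X Y A))) => /=.
rewrite hexagon_l swapE -!comp_assoc fwd_bwd bwdK comp_id_r.
by rewrite /bwhisker -lock -!comp_assoc.
Qed.

Lemma twhisker_swap (X Y Z R W : C) (h : hom (Y ⊗ X ⊗ Z) R) :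
  twhisker (h ∘ swap X Y Z) W = twhisker h W ∘ swap X Y (Z ⊗ W).
Proof. by rewrite !swapE !comp_assoc twhisker_l twhisker_associator. Qed.

Lemma bwhisker_braid (X Y Z W : C) (f : hom (Y ⊗ X) Z) :
  (f ∘ c X Y) ▸ W = (f ▸ W) ∘ swap X Y W.
Proof. by rewrite bwhisker_post swapE comp_assoc -bwhiskerE. Qed.

Lemma swap_bwhisker_r (A X Y Z W : C) (f : hom (X ⊗ Y) Z) :
  swap A Z W ∘ (A ◁ (f ▸ W)) =
  (f ▸ (A ⊗ W)) ∘ ((X ◁ swap A Y W) ∘ swap A X (Y ⊗ W)).
Proof.
rewrite swapE -comp_assoc -twhisker_r braid_bwhisker_r.
rewrite comp_assoc twhisker_swap twhisker_r !comp_assoc bwhisker_bwhisker.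
by rewrite -!comp_assoc (comp_assoc (X ◁ α _ _ _)) -lwhisker_comp -swapE.
Qed.

Lemma swap_bwhisker_l (A X Y Z W : C) (f : hom (X ⊗ Y) Z) :
  swap Z A W ∘ (f ▸ (A ⊗ W)) =
  (A ◁ (f ▸ W)) ∘ (swap X A (Y ⊗ W) ∘ (X ◁ swap Y A W)).
Proof.
rewrite swapE -comp_assoc -twhisker_l braid_bwhisker_l.
by rewrite comp_assoc twhisker_pre_r twhisker_swap -swapE !comp_assoc
           associator_twhisker_r.
Qed.

End BraidedCoherence.

(** * Modules in right-nested form *)

Section Modules.
Context (C : Category) (I : C) (T : Monoidal I) (c : Braiding T).
Context (A : Algebra T).

Local Notation "X ⊗ Y" := (tob T X Y)
  (at level 35, right associativity) : cat_scope.
Local Notation "f ⊠ g" := (thom T f g)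
  (at level 35, right associativity) : cat_scope.
Local Notation "X ◁ g" := (lwhisker T X g) (at level 34, right associativity).
Local Notation "f ▷ W" := (rwhisker T f W) (at level 33, left associativity).
Local Notation "f ▸ W" := (bwhisker f W) (at level 33, left associativity).
Local Notation α := (associator T).
Local Notation σ := (swap c).

(** Write t for the left side.  The hexagon for I ⊗ I, composed with λ, gives
    t ∘ λ = t ∘ (I ◁ t), naturality of λ gives λ ∘ (I ◁ t) = t ∘ λ, and t is
    invertible. *)
Lemma swap_unit (X W : C) :
  (X ◁ lunitor T W) ∘ σ I X W = lunitor T (X ⊗ W).
Proof.
pose t W' := (X ◁ lunitor T W') ∘ σ I X W'.
have lunitor_unit (Y : C) : I ◁ lunitor T Y = lunitor T (I ⊗ Y).
  by apply: (iso_mono (u := lunitor T Y)); rewrite lunitor_natural.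
have tE : t W ∘ lunitor T (I ⊗ X ⊗ W) = t W ∘ (I ◁ t W).
  have := swap_bwhisker_l c X W (lunitor T I : hom (I ⊗ I) I).
  have lE V : (lunitor T I : hom (I ⊗ I) I) ▸ V = lunitor T (I ⊗ V).
    by apply: (iso_epi (u := α I I V)); rewrite -bwhiskerE lunitor_tensor.
  rewrite !lE {1}/t -comp_assoc => ->; rewrite -lunitor_unit.
  rewrite (reassoc (lwhisker_eq T X (lunitor_natural T (lunitor T W)))).
  rewrite lwhisker_comp -!comp_assoc -lunitor_unit.
  rewrite (reassoc (esym (swap_natural c I X (lunitor T W)))).
  by rewrite /t !lwhisker_comp -!comp_assoc.
have tl : lunitor T _ ∘ (I ◁ t W) = t W ∘ lunitor T _ := lunitor_natural _ _.
pose u := iso_comp (lwhisker_iso T X (lunitor T W)) (σ I X W).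
rewrite -/(t W); apply: (iso_epi (u := lwhisker_iso T I u)).
by rewrite /= -/(t W) -tE tl.
Qed.

Definition one_ins (W : C) : hom W (A ⊗ W) :=
  locked ((one A ▷ W) ∘ bwd (lunitor T W)).

Lemma one_insE (W : C) : one A ▷ W = one_ins W ∘ lunitor T W.
Proof. by rewrite /one_ins -lock -comp_assoc bwd_fwd comp_id_r. Qed.

Lemma one_ins_natural (W W' : C) (g : hom W W') :
  one_ins W' ∘ g = (A ◁ g) ∘ one_ins W.
Proof.
apply: (iso_epi (u := lunitor T W)); rewrite -!comp_assoc -one_insE.
by rewrite -lunitor_natural comp_assoc -one_insE whisker_exchange.
Qed.

Lemma swap_one_ins (X W : C) : σ A X W ∘ one_ins (X ⊗ W) = X ◁ one_ins W.
Proof.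
apply: (iso_epi (u := lunitor T (X ⊗ W))).
rewrite -comp_assoc -one_insE swap_natural_l one_insE lwhisker_comp.
by rewrite -comp_assoc swap_unit.
Qed.

Lemma one_ins_tensor (Y W : C) : α A Y W ∘ (one_ins Y ▷ W) = one_ins (Y ⊗ W).
Proof.
apply: (iso_epi (u := rwhisker_iso T W (lunitor T Y))) => /=.
rewrite -comp_assoc -rwhisker_comp -one_insE associator_rr -lunitor_tensor.
by rewrite comp_assoc one_insE.
Qed.

Lemma is_module_intro (M : C) (a : hom (A ⊗ M) M) :
  a ∘ (mul A ▸ M) = a ∘ (A ◁ a) -> a ∘ one_ins M = idm M -> is_module a.
Proof.
move=> aA a1; split; first by rewrite -/(rwhisker T _ _) bwhiskerE comp_assoc aA.
by rewrite -/(rwhisker T _ _) one_insE comp_assoc a1 comp_id_l.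
Qed.

Section Action.
Context (M : Module A).

Lemma act_mul : act M ∘ (mul A ▸ M) = act M ∘ (A ◁ act M).
Proof.
apply: (iso_epi (u := α A A M)); rewrite -comp_assoc -bwhiskerE.
exact: (module_assoc (act_module M)).
Qed.

Lemma act_mul_whisker (W : C) :
  (act M ▸ W) ∘ (mul A ▸ (M ⊗ W)) = (act M ▸ W) ∘ (A ◁ (act M ▸ W)).
Proof. by rewrite -twhisker_l act_mul twhisker_r. Qed.

Lemma act_one : act M ∘ one_ins M = idm M.
Proof.
apply: (iso_epi (u := lunitor T M)); rewrite -comp_assoc -one_insE comp_id_l.
exact: (module_unit (act_module M)).
Qed.

Lemma act_one_whisker (W : C) : (act M ▸ W) ∘ one_ins (M ⊗ W) = idm (M ⊗ W).
Proof.
by rewrite -one_ins_tensor comp_assoc -bwhiskerE -rwhisker_comp act_one rwhisker_id.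
Qed.

Lemma local_whisker (hM : is_local c M) (W : C) :
  (act M ▸ W) ∘ (σ M A W ∘ σ A M W) = act M ▸ W.
Proof. by rewrite comp_assoc -!bwhisker_braid hM. Qed.

End Action.

Lemma mul_one_whisker (W : C) : (mul A ▸ W) ∘ one_ins (A ⊗ W) = idm (A ⊗ W).
Proof. exact: (act_one_whisker (regular A)). Qed.

Lemma mul_swap (hA : is_commutative c A) (W : C) :
  (mul A ▸ W) ∘ σ A A W = mul A ▸ W.
Proof. by rewrite -bwhisker_braid hA. Qed.

Definition linear_map (M N : Module A) (f : hom M N) : Prop :=
  f ∘ act M = act N ∘ (A ◁ f).

Lemma linear_whisker (M N : Module A) (f : hom M N) (W : C) :
  linear_map f -> (f ▷ W) ∘ (act M ▸ W) = (act N ▸ W) ∘ (A ◁ (f ▷ W)).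
Proof. by move=> lf; rewrite -bwhisker_post lf bwhisker_pre_r. Qed.

Lemma linear_iso (M N : Module A) (f : Iso M N) :
  linear_map f -> linear_map (bwd f).
Proof.
move=> lf; apply: (iso_mono (u := f)); rewrite comp_assoc fwd_bwd comp_id_l.
rewrite comp_assoc lf -comp_assoc -lwhisker_comp fwd_bwd lwhisker_id.
by rewrite comp_id_r.
Qed.

End Modules.

(** * Balanced maps and the induced action *)

Section Balanced.
Context (C : Category) (I : C) (T : Monoidal I) (c : Braiding T).
Context (A : Algebra T).

Local Notation "X ⊗ Y" := (tob T X Y)
  (at level 35, right associativity) : cat_scope.
Local Notation "f ⊠ g" := (thom T f g)
  (at level 35, right associativity) : cat_scope.
Local Notation "X ◁ g" := (lwhisker T X g) (at level 34, right associativity).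
Local Notation "f ▷ W" := (rwhisker T f W) (at level 33, left associativity).
Local Notation "f ▸ W" := (bwhisker f W) (at level 33, left associativity).
Local Notation α := (associator T).
Local Notation σ := (swap c).

Definition balanced (M N : Module A) (R : C) (h : hom (M ⊗ N) R) : Prop :=
  h ∘ (act M ▸ N) = h ∘ ((M ◁ act N) ∘ σ A M N).

Definition is_balanced_tensor (M N : Module A) (Q : C) (q : hom (M ⊗ N) Q) :=
  is_coequalizer (act M ▸ N) ((M ◁ act N) ∘ σ A M N) q.

Lemma balanced_whisker (M N : Module A) (R W : C) (h : hom (M ⊗ N) R) :
  balanced h ->
  (h ▸ W) ∘ (act M ▸ (N ⊗ W)) =
  (h ▸ W) ∘ ((M ◁ (act N ▸ W)) ∘ σ A M (N ⊗ W)).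
Proof.
by move=> hb; rewrite -twhisker_l hb !comp_assoc twhisker_swap twhisker_r.
Qed.

Lemma balanced_bwd (M N : Module A) (R X : C) (h : hom (M ⊗ N) R) (k : hom X _) :
  balanced h -> h ∘ ((act M ▸ N) ∘ (bwd (σ A M N) ∘ k)) = h ∘ ((M ◁ act N) ∘ k).
Proof. by move=> hb; rewrite comp_assoc hb -!comp_assoc fwdK. Qed.

(** The double braiding of A and M acts trivially, so one half of it may be
    replaced by the inverse of the other. *)
Lemma local_whisker_bwd (M : Module A) (W X : C) (k : hom X _) :
  is_local c M -> (act M ▸ W) ∘ (σ M A W ∘ k) = (act M ▸ W) ∘ (bwd (σ A M W) ∘ k).
Proof. by move=> hM; rewrite -[in RHS](local_whisker hM) -!comp_assoc fwdK. Qed.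

(** The two pairs of parallel morphisms differ by the associator of
    (A ⊗ M) ⊗ N. *)
Lemma balanced_tensorP (M N : Module A) (Q : C) (q : hom (M ⊗ N) Q) :
  is_balanced_tensor q <->
  is_coequalizer (act M ⊠ idm N)
    ((idm M ⊠ act N) ∘ α M A N ∘ (c A M ⊠ idm N)) q.
Proof.
have e1 : (act M ▸ N) ∘ α A M N = act M ⊠ idm N by rewrite -bwhiskerE.
have e2 : ((M ◁ act N) ∘ σ A M N) ∘ α A M N =
          (idm M ⊠ act N) ∘ α M A N ∘ (c A M ⊠ idm N).
  by rewrite swapE -!comp_assoc -bwhiskerE.
split.
  apply: (coequalizer_iso (u := iso_inv (α A M N)) (v := iso_id _) (w := iso_id _));
    rewrite /= ?comp_id_l ?comp_id_r // -?e1 -?e2.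
    by rewrite -comp_assoc fwd_bwd comp_id_r.
  by rewrite -comp_assoc fwd_bwd comp_id_r.
apply: (coequalizer_iso (u := α A M N) (v := iso_id _) (w := iso_id _));
  by rewrite /= ?comp_id_l ?comp_id_r // -?e1 -?e2.
Qed.

Section Preservation.
Hypothesis tensor_coequalizer_l : tensor_preserves_coequalizers T.

(** The braiding exchanges the two variables of the tensor product. *)
Lemma tensor_coequalizer_r (W X Y Q : C) (f g : hom X Y) (q : hom Y Q) :
  is_coequalizer f g q -> is_coequalizer (W ◁ f) (W ◁ g) (W ◁ q).
Proof.
move=> /(tensor_coequalizer_l W).
by apply: (coequalizer_iso (u := c _ _) (v := c _ _) (w := c _ _));
  rewrite braid_natural_l.
Qed.

Lemma balanced_tensor_whisker (M N : Module A) (Q : C) (q : hom (M ⊗ N) Q) (W : C) :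
  is_balanced_tensor q ->
  is_coequalizer (act M ▸ (N ⊗ W)) ((M ◁ (act N ▸ W)) ∘ σ A M (N ⊗ W)) (q ▸ W).
Proof.
move=> /(tensor_coequalizer_l W).
apply: (coequalizer_iso
  (u := iso_comp (lwhisker_iso T A (α M N W)) (α A (M ⊗ N) W))
  (v := α M N W) (w := iso_id _)) => /=.
- by rewrite rwhisker_twhisker (reassoc (associator_twhisker_l _ _ _)).
- by rewrite rwhisker_twhisker twhisker_swap !comp_assoc associator_twhisker_r.
- by rewrite /= -bwhiskerE comp_id_l.
Qed.

End Preservation.
End Balanced.

Section InducedAction.
Context (C : Category) (I : C) (T : Monoidal I) (c : Braiding T).
Context (A : Algebra T) (hA : is_commutative c A).

Local Notation "X ⊗ Y" := (tob T X Y)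
  (at level 35, right associativity) : cat_scope.
Local Notation "f ⊠ g" := (thom T f g)
  (at level 35, right associativity) : cat_scope.
Local Notation "X ◁ g" := (lwhisker T X g) (at level 34, right associativity).
Local Notation "f ▷ W" := (rwhisker T f W) (at level 33, left associativity).
Local Notation "f ▸ W" := (bwhisker f W) (at level 33, left associativity).
Local Notation α := (associator T).
Local Notation σ := (swap c).

Hypothesis tensor_coequalizer_l : tensor_preserves_coequalizers T.

Context (M N : Module A) (Q : C) (q : hom (M ⊗ N) Q).
Hypothesis hq : is_balanced_tensor c q.

Let q_balanced : balanced c q := proj1 hq.
Let q_epi : is_epi q := coequalizer_epi hq.

(** Acting on the left factor of M ⊗ N respects the relation that defines the
    coequalizer because A is commutative: both sides become the action of a
    product of two elements of A, taken in the two possible orders. *)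
Lemma induced_action_compatible :
  q ∘ (act M ▸ N) ∘ (A ◁ (act M ▸ N)) =
  q ∘ (act M ▸ N) ∘ (A ◁ ((M ◁ act N) ∘ σ A M N)).
Proof.
apply: (iso_epi (u := σ A A (M ⊗ N))); rewrite lwhisker_comp -!comp_assoc.
rewrite (reassoc (esym (act_mul_whisker M N))) -comp_assoc mul_swap //.
rewrite act_mul_whisker (reassoc (bwhisker_natural _ _)) -!comp_assoc.
by rewrite -swap_bwhisker_r (comp_assoc q) q_balanced -!comp_assoc.
Qed.

Definition induced_action : hom (A ⊗ Q) Q :=
  sval (descend (tensor_coequalizer_r c tensor_coequalizer_l A hq)
          induced_action_compatible).

Lemma induced_actionE : induced_action ∘ (A ◁ q) = q ∘ (act M ▸ N).
Proof.
exact: (svalP (descend (tensor_coequalizer_r c tensor_coequalizer_l A hq)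
          induced_action_compatible)).
Qed.

Lemma induced_action_module : is_module induced_action.
Proof.
apply: is_module_intro.
  have := tensor_coequalizer_r c tensor_coequalizer_l A hq.
  move=> /(tensor_coequalizer_r c tensor_coequalizer_l A) /coequalizer_epi; apply.
  rewrite -!comp_assoc bwhisker_natural comp_assoc induced_actionE -comp_assoc.
  rewrite act_mul_whisker -lwhisker_comp induced_actionE lwhisker_comp.
  by rewrite comp_assoc -induced_actionE -comp_assoc.
apply: q_epi; rewrite -comp_assoc one_ins_natural comp_assoc induced_actionE.
by rewrite -comp_assoc act_one_whisker comp_id_l comp_id_r.
Qed.

Definition induced_module : Module A := Build_Module induced_action_module.

(** The double braiding of A with M ⊗ N is made of the double braidings with
    M and with N.  The one with M is absorbed by the action on M; moving the
    action over to N along the relation absorbs the other one. *)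
Lemma induced_module_local :
  is_local c M -> is_local c N -> is_local c induced_module.
Proof.
move=> hM hN; rewrite /is_local.
apply: (coequalizer_epi (tensor_coequalizer_r c tensor_coequalizer_l A hq)).
rewrite -!comp_assoc braid_bwhisker_r (reassoc (braid_bwhisker_l _ _ _)).
rewrite -!comp_assoc (reassoc induced_actionE) induced_actionE -!comp_assoc.
rewrite local_whisker_bwd // (balanced_bwd _ q_balanced).
have := lwhisker_eq T M hN; rewrite lwhisker_comp => /reassoc e.
by rewrite (comp_assoc (M ◁ act N)) e q_balanced.
Qed.

End InducedAction.

(** * Relative tensor products of modules *)

Section RelativeTensorStructure.
Context (C : Category) (I : C) (T : Monoidal I) (c : Braiding T).
Context (A : Algebra T) (hA : is_commutative c A).

Local Notation "X ⊗ Y" := (tob T X Y)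
  (at level 35, right associativity) : cat_scope.
Local Notation "f ⊠ g" := (thom T f g)
  (at level 35, right associativity) : cat_scope.
Local Notation "X ◁ g" := (lwhisker T X g) (at level 34, right associativity).
Local Notation "f ▷ W" := (rwhisker T f W) (at level 33, left associativity).
Local Notation "f ▸ W" := (bwhisker f W) (at level 33, left associativity).
Local Notation α := (associator T).
Local Notation σ := (swap c).

Hypothesis tensor_coequalizer_l : tensor_preserves_coequalizers T.

(** A choice of relative tensor products with the induced action.  It is kept
    abstract, so that only the universal property can enter the proofs. *)
Context (rel : Module A -> Module A -> Module A).
Local Notation "M ⊙ N" := (rel M N) (at level 35, right associativity).
Context (π : forall M N : Module A, hom (M ⊗ N) (M ⊙ N)).
Hypothesis pr_coequalizer : forall M N : Module A, is_balanced_tensor c (π M N).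
Hypothesis act_pr : forall M N : Module A,
  act (M ⊙ N) ∘ (A ◁ π M N) = π M N ∘ (act M ▸ N).

Lemma pr_balanced (M N : Module A) : balanced c (π M N).
Proof. exact: (proj1 (pr_coequalizer M N)). Qed.

Lemma pr_epi (M N : Module A) : is_epi (π M N).
Proof. exact: (coequalizer_epi (pr_coequalizer M N)). Qed.

Lemma pr_whisker_coequalizer (M N : Module A) (W : C) :
  is_coequalizer (act M ▸ (N ⊗ W)) ((M ◁ (act N ▸ W)) ∘ σ A M (N ⊗ W)) (π M N ▸ W).
Proof. exact: balanced_tensor_whisker. Qed.

Lemma lwhisker_epi (V X Y Q : C) (f g : hom X Y) (q : hom Y Q) :
  is_coequalizer f g q -> is_epi (V ◁ q).
Proof.
by move=> /(tensor_coequalizer_r c tensor_coequalizer_l V) /coequalizer_epi.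
Qed.

Lemma act_pr_whisker (M N : Module A) (W : C) :
  (act (M ⊙ N) ▸ W) ∘ (A ◁ (π M N ▸ W)) = (π M N ▸ W) ∘ (act M ▸ (N ⊗ W)).
Proof. by rewrite -twhisker_r act_pr twhisker_l. Qed.

Definition rel_desc (M N : Module A) (R : C) (h : hom (M ⊗ N) R)
    (hb : balanced c h) : hom (M ⊙ N) R :=
  sval (descend (pr_coequalizer M N) hb).

Lemma rel_descE (M N : Module A) (R : C) (h : hom (M ⊗ N) R)
    (hb : balanced c h) : rel_desc hb ∘ π M N = h.
Proof. exact: (svalP (descend (pr_coequalizer M N) hb)). Qed.

(** Linearity of a map out of a relative tensor product can be tested before
    projecting, where the action is the one on the left factor. *)
Lemma rel_linear (M N P : Module A) (u : hom (M ⊙ N) P) :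
  u ∘ π M N ∘ (act M ▸ N) = act P ∘ (A ◁ (u ∘ π M N)) -> linear_map u.
Proof.
move=> e; rewrite /linear_map; apply: (lwhisker_epi (pr_coequalizer M N) (V := A)).
by rewrite -!comp_assoc act_pr comp_assoc e lwhisker_comp.
Qed.

Section Hom.
Context (M M' N N' : Module A) (f : hom M M') (g : hom N N').
Hypotheses (lf : linear_map f) (lg : linear_map g).

Lemma rel_hom_balanced : balanced c (π M' N' ∘ (f ⊠ g)).
Proof.
rewrite /balanced thomE -!comp_assoc -bwhisker_natural.
rewrite (reassoc (linear_whisker _ lf)) -comp_assoc.
rewrite (reassoc (pr_balanced _ _)) -!comp_assoc.
rewrite (reassoc (swap_natural_r _ _ _ _)) -comp_assoc swap_natural.
rewrite (reassoc (esym (whisker_exchange _ _ _))) -!comp_assoc.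
by rewrite (reassoc (lwhisker_eq T M (esym lg))) lwhisker_comp -!comp_assoc.
Qed.

Definition rel_map : hom (M ⊙ N) (M' ⊙ N') := rel_desc rel_hom_balanced.

Lemma rel_mapE : rel_map ∘ π M N = π M' N' ∘ (f ⊠ g).
Proof. exact: rel_descE. Qed.

Lemma rel_map_linear : linear_map rel_map.
Proof.
apply: rel_linear; rewrite rel_mapE lwhisker_comp (comp_assoc (act _)) act_pr.
rewrite thomE -!comp_assoc -bwhisker_natural (reassoc (linear_whisker _ lf)).
by rewrite lwhisker_comp -!comp_assoc.
Qed.

End Hom.

Section Associator.
Context (M N P : Module A).

(** The associator is built by descending twice, first along the projection of
    M ⊗ N and then along that of (M ⊙ N) ⊗ P. *)
Lemma rel_assoc1_compatible :
  π M (N ⊙ P) ∘ (M ◁ π N P) ∘ (act M ▸ (N ⊗ P)) =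
  π M (N ⊙ P) ∘ (M ◁ π N P) ∘ ((M ◁ (act N ▸ P)) ∘ σ A M (N ⊗ P)).
Proof.
rewrite -!comp_assoc -bwhisker_natural (reassoc (pr_balanced _ _)).
rewrite -!comp_assoc swap_natural (reassoc (lwhisker_eq T _ (act_pr _ _))).
by rewrite lwhisker_comp -comp_assoc.
Qed.

Definition rel_assoc1 : hom ((M ⊙ N) ⊗ P) (M ⊙ N ⊙ P) :=
  sval (descend (pr_whisker_coequalizer M N P) rel_assoc1_compatible).

Lemma rel_assoc1E : rel_assoc1 ∘ (π M N ▸ P) = π M (N ⊙ P) ∘ (M ◁ π N P).
Proof.
exact: (svalP (descend (pr_whisker_coequalizer M N P) rel_assoc1_compatible)).
Qed.

Lemma rel_pr_pr_epi (V : C) : is_epi (V ◁ (π M N ▸ P)).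
Proof. exact: (lwhisker_epi (pr_whisker_coequalizer M N P)). Qed.

Lemma rel_assoc1_balanced : balanced c rel_assoc1.
Proof.
apply: (rel_pr_pr_epi (V := A)).
rewrite /balanced -!comp_assoc act_pr_whisker swap_bwhisker_r.
rewrite (reassoc (esym (bwhisker_natural _ _))) -comp_assoc !(reassoc rel_assoc1E).
rewrite rel_assoc1_compatible -!comp_assoc.
rewrite (reassoc (lwhisker_eq T _ (pr_balanced _ _))).
by rewrite !lwhisker_comp -!comp_assoc.
Qed.

Definition rel_assoc_map : hom ((M ⊙ N) ⊙ P) (M ⊙ N ⊙ P) :=
  rel_desc rel_assoc1_balanced.

Lemma rel_assoc_mapE :
  rel_assoc_map ∘ (π (M ⊙ N) P ∘ (π M N ▸ P)) = π M (N ⊙ P) ∘ (M ◁ π N P).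
Proof. by rewrite comp_assoc rel_descE rel_assoc1E. Qed.

Lemma rel_assoc_map_linear : linear_map rel_assoc_map.
Proof.
apply: rel_linear; apply: (rel_pr_pr_epi (V := A)).
rewrite -!comp_assoc act_pr_whisker -lwhisker_comp -comp_assoc.
rewrite rel_assoc_mapE lwhisker_comp (comp_assoc (π _ _)) (comp_assoc rel_assoc_map).
rewrite rel_assoc_mapE (reassoc (act_pr _ _)) -!comp_assoc.
by rewrite bwhisker_natural.
Qed.

(** The inverse of the associator is built in the same way from the other
    bracketing. *)
Lemma rel_assoc2_compatible :
  π (M ⊙ N) P ∘ (π M N ▸ P) ∘ (M ◁ (act N ▸ P)) =
  π (M ⊙ N) P ∘ (π M N ▸ P) ∘ (M ◁ ((N ◁ act P) ∘ σ A N P)).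
Proof.
apply: (iso_epi (u := σ A M (N ⊗ P))).
rewrite lwhisker_comp -!comp_assoc -(balanced_whisker _ (pr_balanced _ _)).
rewrite (reassoc (bwhisker_natural _ _)) -!comp_assoc -swap_bwhisker_r.
by rewrite -act_pr_whisker (reassoc (pr_balanced _ _)) -!comp_assoc.
Qed.

Definition rel_assoc2 : hom (M ⊗ (N ⊙ P)) ((M ⊙ N) ⊙ P) :=
  sval (descend (tensor_coequalizer_r c tensor_coequalizer_l M (pr_coequalizer N P))
          rel_assoc2_compatible).

Lemma rel_assoc2E : rel_assoc2 ∘ (M ◁ π N P) = π (M ⊙ N) P ∘ (π M N ▸ P).
Proof.
exact: (svalP (descend
  (tensor_coequalizer_r c tensor_coequalizer_l M (pr_coequalizer N P))
  rel_assoc2_compatible)).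
Qed.

Lemma rel_assoc2_balanced : balanced c rel_assoc2.
Proof.
have := tensor_coequalizer_r c tensor_coequalizer_l M (pr_coequalizer N P).
move=> /(lwhisker_epi (V := A)); apply.
rewrite /balanced -!comp_assoc bwhisker_natural swap_natural.
rewrite (reassoc (lwhisker_eq T _ (act_pr _ _))) lwhisker_comp -!comp_assoc.
rewrite !(reassoc rel_assoc2E) -!comp_assoc.
by rewrite (balanced_whisker _ (pr_balanced _ _)).
Qed.

Definition rel_assoc_inv : hom (M ⊙ N ⊙ P) ((M ⊙ N) ⊙ P) :=
  rel_desc rel_assoc2_balanced.

Lemma rel_assoc_invE :
  rel_assoc_inv ∘ (π M (N ⊙ P) ∘ (M ◁ π N P)) = π (M ⊙ N) P ∘ (π M N ▸ P).
Proof. by rewrite comp_assoc rel_descE rel_assoc2E. Qed.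

Definition rel_assoc_iso : Iso ((M ⊙ N) ⊙ P) (M ⊙ N ⊙ P).
Proof.
exists rel_assoc_map rel_assoc_inv.
- apply: (epi_comp (@pr_epi (M ⊙ N) P)
    (coequalizer_epi (pr_whisker_coequalizer M N P))).
  by rewrite -comp_assoc rel_assoc_mapE rel_assoc_invE comp_id_l.
- apply: (epi_comp (@pr_epi M (N ⊙ P))
    (lwhisker_epi (pr_coequalizer N P) (V := M))).
  by rewrite -comp_assoc rel_assoc_invE rel_assoc_mapE comp_id_l.
Defined.

End Associator.

Section Unitor.
Context (M : Module A).

Lemma act_balanced : balanced c (M := regular A) (act M).
Proof.
by rewrite /balanced (comp_assoc (act M)) -act_mul -comp_assoc mul_swap.
Qed.

(** In the relation for M ⊗ N with M the regular module, the braiding of A with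
    itself can be omitted since A is commutative. *)
Lemma pr_regular : π (regular A) M ∘ (A ◁ act M) = π (regular A) M ∘ (mul A ▸ M).
Proof.
apply: (iso_epi (u := σ A A M)); rewrite -!comp_assoc mul_swap //.
by rewrite -(pr_balanced (regular A) M).
Qed.

Definition rel_lunitor_map : hom (regular A ⊙ M) M := rel_desc act_balanced.

Lemma rel_lunitor_mapE : rel_lunitor_map ∘ π (regular A) M = act M.
Proof. exact: rel_descE. Qed.

Definition rel_lunitor_iso : Iso (regular A ⊙ M) M.
Proof.
exists rel_lunitor_map (π (regular A) M ∘ one_ins A M).
- apply: pr_epi; rewrite -!comp_assoc rel_lunitor_mapE comp_id_l one_ins_natural.
  by rewrite (reassoc pr_regular) -comp_assoc mul_one_whisker comp_id_r.
- by rewrite comp_assoc rel_lunitor_mapE act_one.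
Defined.

Lemma rel_lunitor_linear : linear_map rel_lunitor_map.
Proof. by apply: rel_linear; rewrite rel_lunitor_mapE act_mul. Qed.

End Unitor.

Section Braid.
Context (M N : Module A) (hM : is_local c M).

(** Naturality of the braiding along the action of M, followed by the relation
    defining N ⊙ M. *)
Lemma pr_braid_act :
  π N M ∘ (c M N ∘ (act M ▸ N)) = π N M ∘ ((act N ▸ M) ∘ (A ◁ c M N)).
Proof.
by rewrite braid_bwhisker_l (comp_assoc (π N M) (act N ▸ M)) pr_balanced -!comp_assoc.
Qed.

(** By [pr_braid_act] the two sides differ by the double braiding of A with M,
    which the action of the local module M absorbs. *)
Lemma rel_braid_balanced : balanced c (π N M ∘ c M N).
Proof.
rewrite /balanced -!comp_assoc [in RHS](reassoc (braid_bwhisker_r _ _ _)) -!comp_assoc.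
rewrite -(local_whisker hM N) (comp_assoc (act N ▸ M)).
by rewrite (reassoc (esym pr_braid_act)) -!comp_assoc.
Qed.

Lemma rel_braid_inv_balanced : balanced c (π M N ∘ bwd (c M N)).
Proof.
(* Afterwards both sides are morphisms on M ⊗ (A ⊗ N), without c_{M,N}. *)
apply: (iso_epi (u := iso_comp (lwhisker_iso T A (c M N)) (σ M A N))).
rewrite /= -!comp_assoc -braid_bwhisker_r bwdK.
rewrite (comp_assoc (σ A N M)) (reassoc (esym (braid_bwhisker_l _ _ _))).
rewrite -!comp_assoc bwdK -[σ M A N : hom _ _]comp_id_r local_whisker_bwd //.
by rewrite (balanced_bwd _ (pr_balanced _ _)) comp_id_r.
Qed.

Definition rel_braid_map : hom (M ⊙ N) (N ⊙ M) := rel_desc rel_braid_balanced.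

Lemma rel_braid_mapE : rel_braid_map ∘ π M N = π N M ∘ c M N.
Proof. exact: rel_descE. Qed.

Definition rel_braid_inv : hom (N ⊙ M) (M ⊙ N) := rel_desc rel_braid_inv_balanced.

Lemma rel_braid_invE : rel_braid_inv ∘ π N M = π M N ∘ bwd (c M N).
Proof. exact: rel_descE. Qed.

Definition rel_braid_iso : Iso (M ⊙ N) (N ⊙ M).
Proof.
exists rel_braid_map rel_braid_inv; apply: pr_epi.
- by rewrite -comp_assoc rel_braid_mapE comp_assoc rel_braid_invE -comp_assoc
             bwd_fwd comp_id_l comp_id_r.
- by rewrite -comp_assoc rel_braid_invE comp_assoc rel_braid_mapE -comp_assoc
             fwd_bwd comp_id_l comp_id_r.
Defined.

Lemma rel_braid_linear : linear_map rel_braid_map.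
Proof.
apply: rel_linear; rewrite rel_braid_mapE -comp_assoc pr_braid_act lwhisker_comp.
by rewrite (comp_assoc (act _)) act_pr -comp_assoc.
Qed.

End Braid.

Lemma rel_mapEk (M M' N N' : Module A) (f : hom M M') (g : hom N N')
    (lf : linear_map f) (lg : linear_map g) (X : C) (k : hom X _) :
  rel_map lf lg ∘ (π M N ∘ k) = π M' N' ∘ ((f ⊠ g) ∘ k).
Proof. by rewrite comp_assoc rel_mapE -comp_assoc. Qed.

Lemma rel_assoc_alphaE (M N P : Module A) :
  rel_assoc_map M N P ∘ (π (M ⊙ N) P ∘ (π M N ▷ P)) =
  π M (N ⊙ P) ∘ ((M ◁ π N P) ∘ α M N P).
Proof. by rewrite bwhiskerE (comp_assoc (π _ _)) comp_assoc rel_assoc_mapE -comp_assoc. Qed.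

Lemma rel_assoc_alphaEk (M N P : Module A) (X : C) (k : hom X _) :
  rel_assoc_map M N P ∘ (π (M ⊙ N) P ∘ ((π M N ▷ P) ∘ k)) =
  π M (N ⊙ P) ∘ ((M ◁ π N P) ∘ (α M N P ∘ k)).
Proof. by rewrite (comp_assoc (π _ _)) comp_assoc rel_assoc_alphaE -!comp_assoc. Qed.

Lemma pr_pr_epi (M N P : Module A) : is_epi (π (M ⊙ N) P ∘ (π M N ▷ P)).
Proof.
apply: epi_comp; first exact: pr_epi.
exact: (coequalizer_epi (tensor_coequalizer_l P (pr_coequalizer M N))).
Qed.

Section AssociatorNatural.
Context (M M' N N' P P' : Module A).
Context (f : hom M M') (g : hom N N') (h : hom P P').
Hypotheses (lf : linear_map f) (lg : linear_map g) (lh : linear_map h).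

Lemma rel_assoc_natural :
  rel_assoc_map M' N' P' ∘ rel_map (rel_map_linear lf lg) lh =
  rel_map lf (rel_map_linear lg lh) ∘ rel_assoc_map M N P.
Proof.
apply: pr_pr_epi; rewrite -!comp_assoc rel_assoc_alphaE !rel_mapEk.
rewrite thom_rwhisker rel_mapE -rwhisker_thom (comp_assoc (π _ _)) comp_assoc rel_assoc_alphaE.
rewrite -!comp_assoc associator_natural (reassoc (lwhisker_thom _ _ _ _)).
by rewrite (reassoc (thom_lwhisker _ _ _ _)) rel_mapE.
Qed.

End AssociatorNatural.

Lemma rel_pentagon (M N P Q : Module A)
    (l1 : linear_map (idm M)) (l2 : linear_map (idm Q)) :
  rel_assoc_map M N (P ⊙ Q) ∘ rel_assoc_map (M ⊙ N) P Q =
  rel_map l1 (@rel_assoc_map_linear N P Q) ∘ rel_assoc_map M (N ⊙ P) Q ∘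
    rel_map (@rel_assoc_map_linear M N P) l2.
Proof.
apply: (epi_comp (@pr_pr_epi (M ⊙ N) P Q) (f := (π M N ▷ P) ▷ Q)).
  by apply: coequalizer_epi; do 2!apply: tensor_coequalizer_l; apply: pr_coequalizer.
rewrite -!comp_assoc rel_assoc_alphaEk associator_rr.
rewrite (reassoc (esym (whisker_exchange _ _ _))) -!comp_assoc rel_assoc_alphaEk.
rewrite (reassoc (associator_ll _ _ _ _)) -!comp_assoc.
rewrite rel_mapEk (reassoc (thom_rwhisker _ _ _ _)) thom_rwhisker -comp_assoc rel_assoc_alphaE.
rewrite -/(rwhisker T _ _) !rwhisker_comp rel_assoc_alphaEk (reassoc (associator_lr _ _ _ _)).
rewrite rel_mapEk -/(lwhisker T _ _) -!comp_assoc.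
rewrite (reassoc (lwhisker_eq T M (erefl (π (N ⊙ P) Q ∘ (π N P ▷ Q))))).
rewrite (reassoc (lwhisker_eq T M (rel_assoc_alphaE _ _ _))).
by rewrite !lwhisker_comp -!comp_assoc pentagon_whisker.
Qed.

Lemma rel_runitorE (M : Module A) (hM : is_local c M) :
  rel_lunitor_map M ∘ rel_braid_map (regular A) hM ∘ π M (regular A) = act M ∘ c M A.
Proof. by rewrite -comp_assoc rel_braid_mapE comp_assoc rel_lunitor_mapE. Qed.

(** Since M is local, the right action used by the right unitor is the one used
    in the relation defining the relative tensor product. *)
Lemma rel_triangle (M N : Module A) (hM : is_local c M)
    (l1 : linear_map (idm M)) (l2 : linear_map (idm N))
    (lr : linear_map (rel_lunitor_map M ∘ rel_braid_map (regular A) hM)) :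
  rel_map l1 (@rel_lunitor_linear N) ∘ rel_assoc_map M (regular A) N =
  rel_map lr l2.
Proof.
apply: pr_pr_epi; rewrite -!comp_assoc rel_assoc_alphaE !rel_mapEk.
rewrite (reassoc (thom_lwhisker _ _ _ _)) thom_rwhisker rel_lunitor_mapE.
rewrite rel_runitorE -/(rwhisker T _ _) -/(lwhisker T _ _).
apply: (iso_epi (u := rwhisker_iso T N (c A M))); rewrite /= -!comp_assoc.
rewrite -rwhisker_comp hM (bwhiskerE _ (act M)) (reassoc (pr_balanced _ _)).
by rewrite swapE -!comp_assoc -bwhiskerE.
Qed.

Lemma rel_lunitor_natural (M N : Module A) (f : hom M N)
    (lf : linear_map f) (l1 : linear_map (idm (regular A : C))) :
  rel_lunitor_map N ∘ rel_map l1 lf = f ∘ rel_lunitor_map M.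
Proof.
apply: pr_epi; rewrite -!comp_assoc rel_mapE rel_lunitor_mapE lf.
by rewrite comp_assoc rel_lunitor_mapE.
Qed.

Lemma rel_braid_natural (M M' N N' : Module A) (f : hom M M') (g : hom N N')
    (lf : linear_map f) (lg : linear_map g) (hM : is_local c M) (hM' : is_local c M') :
  rel_braid_map N' hM' ∘ rel_map lf lg = rel_map lg lf ∘ rel_braid_map N hM.
Proof.
apply: pr_epi; rewrite -!comp_assoc rel_mapE rel_braid_mapE rel_mapEk.
by rewrite comp_assoc rel_braid_mapE -comp_assoc braid_natural.
Qed.

Lemma rel_assoc_inv_alphaE (M N P : Module A) :
  rel_assoc_inv M N P ∘ (π M (N ⊙ P) ∘ (M ◁ π N P)) =
  π (M ⊙ N) P ∘ ((π M N ▷ P) ∘ bwd (α M N P)).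
Proof. by rewrite rel_assoc_invE bwhiskerE -!comp_assoc fwd_bwd comp_id_r. Qed.

Lemma rel_assoc_inv_alphaEk (M N P : Module A) (X : C) (k : hom X _) :
  rel_assoc_inv M N P ∘ (π M (N ⊙ P) ∘ ((M ◁ π N P) ∘ k)) =
  π (M ⊙ N) P ∘ ((π M N ▷ P) ∘ (bwd (α M N P) ∘ k)).
Proof. by rewrite (comp_assoc (π _ _)) comp_assoc rel_assoc_inv_alphaE -!comp_assoc. Qed.

Lemma rel_runitor_natural (M N : Module A) (f : hom M N)
    (lf : linear_map f) (l1 : linear_map (idm (regular A : C)))
    (hM : is_local c M) (hN : is_local c N) :
  rel_lunitor_map N ∘ rel_braid_map (regular A) hN ∘ rel_map lf l1 =
  f ∘ (rel_lunitor_map M ∘ rel_braid_map (regular A) hM).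
Proof.
by rewrite -comp_assoc rel_braid_natural comp_assoc rel_lunitor_natural comp_assoc.
Qed.

Section Hexagon.
Context (M N P : Module A) (hM : is_local c M).

Lemma rel_hexagon_r (lN : linear_map (idm N)) (lP : linear_map (idm P)) :
  rel_assoc_map N P M ∘ rel_braid_map (N ⊙ P) hM ∘ rel_assoc_map M N P =
  rel_map lN (rel_braid_linear P hM) ∘ rel_assoc_map N M P ∘
    rel_map (rel_braid_linear N hM) lP.
Proof.
apply: pr_pr_epi; rewrite -!comp_assoc rel_assoc_alphaE rel_mapEk.
rewrite (reassoc (rel_braid_mapE _ _)) -!comp_assoc.
rewrite (reassoc (braid_natural_r _ _ _)) -!comp_assoc rel_assoc_alphaEk.
rewrite thom_rwhisker rel_braid_mapE -/(rwhisker T _ _) rwhisker_comp rel_assoc_alphaEk.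
rewrite rel_mapEk (reassoc (thom_lwhisker _ _ _ _)) rel_braid_mapE.
rewrite -/(lwhisker T _ _) lwhisker_comp -!comp_assoc.
by have := hexagon_r c M N P; rewrite -!comp_assoc => ->.
Qed.

Lemma rel_hexagon_l (hN : is_local c N) (hMN : is_local c (M ⊙ N))
    (lM : linear_map (idm M)) (lN : linear_map (idm N)) :
  rel_assoc_inv P M N ∘ rel_braid_map P hMN ∘ rel_assoc_inv M N P =
  rel_map (rel_braid_linear P hM) lN ∘ rel_assoc_inv M P N ∘
    rel_map lM (rel_braid_linear P hN).
Proof.
apply: (epi_comp (@pr_epi M (N ⊙ P)) (lwhisker_epi (pr_coequalizer N P) (V := M))).
rewrite -!comp_assoc rel_assoc_inv_alphaE rel_mapEk.
rewrite (reassoc (rel_braid_mapE _ _)) -!comp_assoc.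
rewrite (reassoc (braid_natural_l _ _ _)) -!comp_assoc rel_assoc_inv_alphaEk.
rewrite thom_lwhisker rel_braid_mapE -/(lwhisker T _ _) lwhisker_comp rel_assoc_inv_alphaEk.
rewrite rel_mapEk (reassoc (thom_rwhisker _ _ _ _)) rel_braid_mapE.
rewrite -/(rwhisker T _ _) rwhisker_comp -!comp_assoc.
by have := hexagon_l c M N P; rewrite -!comp_assoc => ->.
Qed.

End Hexagon.

End RelativeTensorStructure.

(** * The braided monoidal category of local modules *)

Section LocalModules.
Context (C : Category) (I : C) (T : Monoidal I) (c : Braiding T) (A : Algebra T).
Local Notation Loc := (local_modules A c).
Local Notation "⌊ M ⌋" := (underlying M) (format "⌊ M ⌋") : cat_scope.
Local Notation "⟦ f ⟧" := (underlying_hom f) (format "⟦ f ⟧") : cat_scope.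

Lemma underlying_inj (M N : Loc) (f g : hom M N) : ⟦f⟧ = ⟦g⟧ -> f = g.
Proof. exact: mhom_inj. Qed.

Lemma underlying_comp (M N P : Loc) (g : hom N P) (f : hom M N) :
  ⟦g ∘ f⟧ = ⟦g⟧ ∘ ⟦f⟧.
Proof. by []. Qed.

Definition underlying_linear (M N : Loc) (f : hom M N) : linear_map ⟦f⟧ :=
  mhom_act f.

Definition local_hom (M N : Loc) (f : hom (⌊M⌋ : C) ⌊N⌋) (lf : linear_map f) :
  hom M N := Build_ModuleHom lf.

Definition local_iso (M N : Loc) (u : Iso (⌊M⌋ : C) ⌊N⌋) (lu : linear_map u) :
  Iso M N.
Proof.
exists (local_hom lu) (local_hom (linear_iso lu)); apply: underlying_inj.
- exact: bwd_fwd.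
- exact: fwd_bwd.
Defined.

End LocalModules.

Section RelativeTensorExists.
Context (C : Category) (I : C) (T : Monoidal I) (c : Braiding T).
Context (A : Algebra T) (hA : is_commutative c A).

Local Notation "X ⊗ Y" := (tob T X Y)
  (at level 35, right associativity) : cat_scope.
Local Notation "f ⊠ g" := (thom T f g)
  (at level 35, right associativity) : cat_scope.
Local Notation "X ◁ g" := (lwhisker T X g) (at level 34, right associativity).
Local Notation "f ▷ W" := (rwhisker T f W) (at level 33, left associativity).
Local Notation "f ▸ W" := (bwhisker f W) (at level 33, left associativity).
Local Notation α := (associator T).
Local Notation Loc := (local_modules A c).
Local Notation "⌊ M ⌋" := (underlying M) (format "⌊ M ⌋") : cat_scope.
Local Notation "⟦ f ⟧" := (underlying_hom f) (format "⟦ f ⟧") : cat_scope.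

Hypothesis tensor_coequalizer_l : tensor_preserves_coequalizers T.

Section Choice.
Context (rel : Module A -> Module A -> Module A).
Local Notation "M ⊙ N" := (rel M N) (at level 35, right associativity).
Context (π : forall M N : Module A, hom (M ⊗ N) (M ⊙ N)).
Hypothesis pr_coequalizer : forall M N : Module A, is_balanced_tensor c (π M N).
Hypothesis act_pr : forall M N : Module A,
  act (M ⊙ N) ∘ (A ◁ π M N) = π M N ∘ (act M ▸ N).
Hypothesis rel_local : forall M N : Module A,
  is_local c M -> is_local c N -> is_local c (M ⊙ N).

Local Notation unit_module := (regular_local_module hA).

Definition local_tensor (M N : Loc) : Loc :=
  exist _ (⌊M⌋ ⊙ ⌊N⌋) (rel_local (svalP M) (svalP N)).

Definition local_tensor_map (M M' N N' : Loc) (f : hom M M') (g : hom N N') :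
  hom (local_tensor M N) (local_tensor M' N') :=
  local_hom (M := local_tensor M N) (N := local_tensor M' N')
    (rel_map_linear tensor_coequalizer_l pr_coequalizer act_pr
      (underlying_linear f) (underlying_linear g)).

Definition local_associator (M N P : Loc) :
  Iso (local_tensor (local_tensor M N) P) (local_tensor M (local_tensor N P)) :=
  local_iso (M := local_tensor (local_tensor M N) P)
    (N := local_tensor M (local_tensor N P))
    (u := rel_assoc_iso tensor_coequalizer_l pr_coequalizer act_pr ⌊M⌋ ⌊N⌋ ⌊P⌋)
    (@rel_assoc_map_linear _ _ _ _ _ tensor_coequalizer_l _ _ pr_coequalizer act_pr
       ⌊M⌋ ⌊N⌋ ⌊P⌋).

Definition local_lunitor (M : Loc) : Iso (local_tensor unit_module M) M :=
  local_iso (M := local_tensor unit_module M) (N := M)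
    (u := rel_lunitor_iso hA pr_coequalizer ⌊M⌋)
    (@rel_lunitor_linear _ _ _ _ _ hA tensor_coequalizer_l _ _ pr_coequalizer act_pr ⌊M⌋).

Definition local_braid (M N : Loc) : Iso (local_tensor M N) (local_tensor N M) :=
  local_iso (M := local_tensor M N) (N := local_tensor N M)
    (u := rel_braid_iso pr_coequalizer ⌊N⌋ (svalP M))
    (@rel_braid_linear _ _ _ _ _ tensor_coequalizer_l _ _ pr_coequalizer act_pr
       ⌊M⌋ ⌊N⌋ (svalP M)).

Definition local_runitor (M : Loc) : Iso (local_tensor M unit_module) M :=
  iso_comp (local_lunitor M) (local_braid M unit_module).

Definition local_monoidal : @Monoidal Loc unit_module.
Proof.
refine {| tob := local_tensor;
          thom := local_tensor_map;
          associator := local_associator;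
          lunitor := local_lunitor;
          runitor := local_runitor |}.
- move=> M N; apply: underlying_inj; apply: (pr_epi pr_coequalizer).
  by rewrite [LHS]rel_mapE thom_id comp_id_l comp_id_r.
- move=> M M' M'' N N' N'' f' f g' g; apply: underlying_inj.
  apply: (pr_epi pr_coequalizer).
  rewrite [LHS]rel_mapE [in LHS]thom_comp underlying_comp -[RHS]comp_assoc.
  by rewrite [in RHS]rel_mapE [RHS]rel_mapEk.
- by move=> *; apply: underlying_inj; apply: rel_assoc_natural.
- by move=> *; apply: underlying_inj; apply: rel_lunitor_natural.
- by move=> *; apply: underlying_inj; apply: rel_runitor_natural.
- by move=> *; apply: underlying_inj; apply: rel_triangle.
- by move=> *; apply: underlying_inj; apply: rel_pentagon.
Defined.

Definition local_braiding : Braiding local_monoidal.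
Proof.
exists local_braid.
- by move=> *; apply: underlying_inj; apply: rel_braid_natural.
- by move=> *; apply: underlying_inj; apply: rel_hexagon_r.
- by move=> *; apply: underlying_inj; apply: rel_hexagon_l.
Defined.

Definition local_relative_tensor : RelativeTensor hA.
Proof.
exists local_monoidal local_braiding (fun M N => π ⌊M⌋ ⌊N⌋).
- by move=> M N; apply/balanced_tensorP/pr_coequalizer.
- by move=> M N; rewrite [LHS]act_pr -[RHS]comp_assoc /bwhisker -lock.
- by move=> *; apply: rel_mapE.
- move=> M N P; rewrite -[LHS]comp_assoc [LHS]rel_assoc_alphaE.
  by rewrite comp_assoc.
- by move=> *; apply: rel_lunitor_mapE.
- by move=> *; apply: rel_runitorE.
- by move=> *; apply: rel_braid_mapE.
Defined.

End Choice.

Hypothesis has_coequalizers : forall (X Y : C) (f g : hom X Y),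
  exists (Q : C) (q : hom Y Q), is_coequalizer f g q.

Lemma relative_tensor_exists : inhabited (RelativeTensor hA).
Proof.
have R (M N : Module A) : {Q : Module A & {q : hom (M ⊗ N) Q |
    [/\ is_balanced_tensor c q, act Q ∘ (A ◁ q) = q ∘ (act M ▸ N) &
        (is_local c M -> is_local c N -> is_local c Q)]}}.
  have /constructive_indefinite_description [Q eQ] :=
    has_coequalizers (act M ▸ N) ((M ◁ act N) ∘ swap c A M N).
  have [q hq] := constructive_indefinite_description _ eQ.
  exists (induced_module hA tensor_coequalizer_l hq), q; split => //.
    exact: induced_actionE.
  exact: induced_module_local.
split; apply: (@local_relative_tensor (fun M N => tag (R M N))
  (fun M N => sval (tagged (R M N)))) => M N.
- by have [] := svalP (tagged (R M N)).
- by have [] := svalP (tagged (R M N)).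
- by have [] := svalP (tagged (R M N)).
Qed.

End RelativeTensorExists.

(** * Duality in a braided Grothendieck-Verdier category *)

Lemma nat_iso_faithful (C D : Category) (F : Functor C D) (G : Functor D C)
    (η : NatIso (functor_comp G F) (functor_id C)) (X Y : C) (f g : hom X Y) :
  fmap F f = fmap F g -> f = g.
Proof.
move=> e; apply: (iso_epi (u := η X)).
by rewrite -[LHS](nat_iso_natural η f) -[RHS](nat_iso_natural η g) /= e.
Qed.

(** The preimage is the transport of [fmap G h]; its image under F is h because
    G is faithful as well. *)
Lemma nat_iso_full (C D : Category) (F : Functor C D) (G : Functor D C)
    (η : NatIso (functor_comp G F) (functor_id C))
    (ε : NatIso (functor_comp F G) (functor_id D)) (X Y : C) (h : hom (F X) (F Y)) :
  exists f : hom X Y, fmap F f = h.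
Proof.
exists (η Y ∘ fmap G h ∘ bwd (η X)); apply: (nat_iso_faithful ε).
apply: (iso_mono (u := η Y)).
by rewrite [LHS](nat_iso_natural η) /= -!comp_assoc bwd_fwd comp_id_r.
Qed.

Section Duality.
Context (C : Category) (I : C) (T : Monoidal I) (c : Braiding T).
Context (K : C) (D : GrothendieckVerdier T K).

Local Notation "X ⊗ Y" := (tob T X Y)
  (at level 35, right associativity) : cat_scope.
Local Notation "f ⊠ g" := (thom T f g)
  (at level 35, right associativity) : cat_scope.
Local Notation "X ◁ g" := (lwhisker T X g) (at level 34, right associativity).
Local Notation "f ▷ W" := (rwhisker T f W) (at level 33, left associativity).
Local Notation "f ▸ W" := (bwhisker f W) (at level 33, left associativity).
Local Notation α := (associator T).
Local Notation σ := (swap c).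
Local Notation "X ^∨" := (dual D X) (at level 2, left associativity, format "X ^∨").
Local Notation e := (ev D).

Lemma ev_inj (X Y : C) (f g : hom Y X^∨) : e X ∘ (f ▷ X) = e X ∘ (g ▷ X) -> f = g.
Proof. by move=> efg; rewrite (curry_unique efg); symmetry; apply: curry_unique. Qed.

Lemma dual_map_ev (X Y : C) (f : hom X Y) :
  e X ∘ (dual_map D f ▷ X) = e Y ∘ (Y^∨ ◁ f).
Proof. exact: dual_map_spec. Qed.

Lemma dual_map_inj (X Y : C) (f g : hom X Y) : dual_map D f = dual_map D g -> f = g.
Proof.
have [G [[η] _]] := gv_equivalence D.
exact: (nat_iso_faithful η (X := Y) (Y := X)).
Qed.

Lemma dual_map_full (X Y : C) (h : hom Y^∨ X^∨) : exists f, dual_map D f = h.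
Proof.
have [G [[η] [ε]]] := gv_equivalence D.
exact: (nat_iso_full η ε (X := Y) (Y := X)).
Qed.

(** Pairing X with DX through the braiding turns composition with g into
    composition with Dg.  As D is full and faithful, this pairing therefore
    represents Hom(- ⊗ DX, K) by X: see [pairing_inj] and [pairing_full]. *)
Lemma pairing_dual_map (X Y : C) (g : hom Y X) :
  e X ∘ (c X X^∨ ∘ (g ▷ X^∨)) = e Y ∘ ((dual_map D g ▷ Y) ∘ c Y X^∨).
Proof. by rewrite braid_natural_l !comp_assoc dual_map_ev. Qed.

Lemma pairing_inj (X Y : C) (f g : hom Y X) :
  e X ∘ (c X X^∨ ∘ (f ▷ X^∨)) = e X ∘ (c X X^∨ ∘ (g ▷ X^∨)) -> f = g.
Proof.
rewrite !pairing_dual_map !comp_assoc => /(iso_epi (u := c Y X^∨)) /ev_inj.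
exact: dual_map_inj.
Qed.

Lemma pairing_full (X Y : C) (h : hom (Y ⊗ X^∨) K) :
  exists g : hom Y X, e X ∘ (c X X^∨ ∘ (g ▷ X^∨)) = h.
Proof.
have [g eg] := dual_map_full (curry D (h ∘ bwd (c Y X^∨))).
exists g; rewrite pairing_dual_map eg comp_assoc [X in X ∘ _]ev_curry.
by rewrite -comp_assoc bwd_fwd comp_id_r.
Qed.

(** The comparison of the two objects X and D(DX) that represent
    Hom(- ⊗ DX, K). *)
Definition bidual (X : C) : hom X X^∨ ^∨ := curry D (e X ∘ c X X^∨).

Lemma bidualE (X : C) : e X^∨ ∘ (bidual X ▷ X^∨) = e X ∘ c X X^∨.
Proof. exact: ev_curry. Qed.

Lemma bidual_natural (X Y : C) (f : hom X Y) :
  bidual Y ∘ f = dual_map D (dual_map D f) ∘ bidual X.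
Proof.
apply: ev_inj; rewrite !rwhisker_comp !comp_assoc dual_map_ev bidualE.
rewrite -[RHS]comp_assoc -whisker_exchange !comp_assoc bidualE.
by rewrite -!comp_assoc pairing_dual_map braid_natural_r.
Qed.

Lemma bidual_section (X : C) :
  {g : hom X^∨ ^∨ X | bidual X ∘ g = idm _ /\ g ∘ bidual X = idm _}.
Proof.
apply: constructive_indefinite_description.
have [g eg] := pairing_full (e X^∨).
have bg : bidual X ∘ g = idm X^∨ ^∨.
  apply: ev_inj; rewrite rwhisker_comp comp_assoc bidualE -comp_assoc eg.
  by rewrite rwhisker_id comp_id_r.
exists g; split=> //; apply: pairing_inj.
by rewrite rwhisker_comp (comp_assoc (c _ _)) comp_assoc eg bidualE
  rwhisker_id comp_id_r.
Qed.

Definition bidual_iso (X : C) : Iso X X^∨ ^∨ :=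
  Build_Iso (proj2 (svalP (bidual_section X))) (proj1 (svalP (bidual_section X))).

(** Morphisms Y ⊗ W -> Z correspond to pairings (Y ⊗ W) ⊗ DZ -> K, hence to
    morphisms from Y to D(W ⊗ DZ). *)
Lemma internal_hom (W Z : C) : exists (R : C) (ε : hom (R ⊗ W) Z),
  forall (Y : C) (h : hom (Y ⊗ W) Z), exists! u : hom Y R, ε ∘ (u ▷ W) = h.
Proof.
have [ε eε] := pairing_full (e (W ⊗ Z^∨) ∘ α (W ⊗ Z^∨)^∨ W Z^∨).
exists (W ⊗ Z^∨)^∨, ε => Y h.
have key (u : hom Y (W ⊗ Z^∨)^∨) :
    e Z ∘ (c Z Z^∨ ∘ ((ε ∘ (u ▷ W)) ▷ Z^∨)) =
    e (W ⊗ Z^∨) ∘ ((u ▷ (W ⊗ Z^∨)) ∘ α Y W Z^∨).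
  rewrite rwhisker_comp (comp_assoc (c _ _)) comp_assoc eε -comp_assoc.
  by rewrite associator_rr.
exists (curry D (e Z ∘ (c Z Z^∨ ∘ (h ▸ Z^∨)))); split.
  apply: pairing_inj; rewrite key comp_assoc [X in X ∘ _]ev_curry.
  by rewrite -!comp_assoc -bwhiskerE.
move=> u eu; apply: esym; apply: curry_unique; apply: (iso_epi (u := α Y W Z^∨)).
by rewrite -comp_assoc -key eu -!comp_assoc -bwhiskerE.
Qed.

(** Tensoring with W is a left adjoint by [internal_hom]. *)
Lemma gv_tensor_coequalizer : tensor_preserves_coequalizers T.
Proof.
move=> W X Y Q f g q hq; have [eq U] := hq; split; first by rewrite -!rwhisker_comp eq.
move=> Z h hfg; have [R [ε adj]] := internal_hom W Z.
have adj_inj V (u v : hom V R) : ε ∘ (u ▷ W) = ε ∘ (v ▷ W) -> u = v.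
  move=> euv; have [w [_ uw]] := adj V (ε ∘ (v ▷ W)).
  by rewrite -(uw u euv) (uw v).
have [u [eu _]] := adj Y h.
have [|v [ev _]] := U R u.
  by apply: adj_inj; rewrite !rwhisker_comp !comp_assoc eu.
exists (ε ∘ (v ▷ W)); split; first by rewrite -comp_assoc -rwhisker_comp ev.
move=> w ew; have [w' [ew' _]] := adj Q w; rewrite -ew'; congr (_ ∘ (_ ▷ _)).
apply: (coequalizer_epi hq); apply: adj_inj.
by rewrite !rwhisker_comp !comp_assoc ew' ew -comp_assoc -rwhisker_comp ev.
Qed.

(** * Dual modules *)

Section DualModule.
Context (A : Algebra T) (M : Module A).

(** The action on DM that makes e_M balanced.  For the regular module this is
    literally [dual_act]. *)
Definition dual_action : hom (A ⊗ M^∨) M^∨ :=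
  curry D (e M ∘ (idm M^∨ ⊠ act M) ∘ α M^∨ A M ∘ (c A M^∨ ⊠ idm M)).

Lemma dual_actionE :
  e M ∘ (dual_action ▸ M) = e M ∘ ((M^∨ ◁ act M) ∘ σ A M^∨ M).
Proof.
apply: (iso_epi (u := α A M^∨ M)).
by rewrite -comp_assoc -bwhiskerE [LHS]ev_curry swapE -!comp_assoc -bwhiskerE.
Qed.

Lemma ev_twhisker_inj (X Y Z N : C) (f g : hom (X ⊗ Y ⊗ Z) N^∨) :
  e N ∘ twhisker f N = e N ∘ twhisker g N -> f = g.
Proof. by move=> efg; apply: ev_inj; rewrite !rwhisker_twhisker !comp_assoc efg. Qed.

(** The transpose of a left action is a right action; commutativity of A, in
    the form μ = μ ∘ c, makes the order of the two factors irrelevant. *)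
Lemma dual_action_module (hA : is_commutative c A) : is_module dual_action.
Proof.
apply: is_module_intro.
  (* With μ written as μ ∘ c on one side, the same three braidings appear on
     both sides. *)
  apply: ev_twhisker_inj; rewrite twhisker_l twhisker_r !comp_assoc dual_actionE.
  rewrite -!comp_assoc -(mul_swap hA) (reassoc (swap_bwhisker_l _ _ _ _)) -!comp_assoc.
  rewrite (reassoc (lwhisker_eq T _ (act_mul M))) swap_bwhisker_r.
  rewrite (reassoc (esym (bwhisker_natural _ _))) -comp_assoc.
  rewrite (reassoc dual_actionE) -!comp_assoc (reassoc (swap_natural _ _ _ _)).
  by rewrite lwhisker_comp -!comp_assoc.
apply: ev_inj; rewrite rwhisker_comp (bwhiskerE _ dual_action) -comp_assoc.
rewrite one_ins_tensor comp_assoc dual_actionE -!comp_assoc swap_one_ins.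
by rewrite -lwhisker_comp act_one lwhisker_id rwhisker_id.
Qed.

Context (θ : Twist c) (hθ : is_ribbon D θ).

Lemma twist_mul (X Y Z : C) (f : hom (X ⊗ Y) Z) :
  θ Z ∘ f = f ∘ (c Y X ∘ (c X Y ∘ ((θ X ▷ Y) ∘ (X ◁ θ Y)))).
Proof. by rewrite twist_natural twist_tensor thomE -!comp_assoc. Qed.

Lemma twist_mul_whisker (X Y Z W : C) (f : hom (X ⊗ Y) Z) :
  (θ Z ▷ W) ∘ (f ▸ W) =
  (f ▸ W) ∘ (σ Y X W ∘ (σ X Y W ∘ ((θ X ▷ (Y ⊗ W)) ∘ (X ◁ (θ Y ▷ W))))).
Proof.
by rewrite -bwhisker_post twist_mul !comp_assoc bwhisker_pre_r bwhisker_pre_l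
           !bwhisker_braid.
Qed.

(** The twist axiom for A ⊗ M, with the double braiding absorbed by locality. *)
Lemma twist_act (hM : is_local c M) (X : C) (k : hom X _) :
  θ M ∘ (act M ∘ k) = act M ∘ ((θ A ▷ M) ∘ ((A ◁ θ M) ∘ k)).
Proof. by rewrite (comp_assoc (θ M)) twist_mul !comp_assoc hM. Qed.

(** Precompose the claim with the isomorphism θ_A ⊗ θ_DM.  On one side the twist
    axiom moves all twists to the left of the action on DM, and Dθ_M = θ_DM moves
    them onto M.  On the other side the twists move onto M directly, where
    [twist_act] leaves an extra θ_A ∘ θ_A. *)
Lemma dual_action_local (hA : is_commutative c A) (hM : is_local c M) :
  θ A ∘ θ A = idm A -> is_local c (Build_Module (dual_action_module hA)).
Proof.
move=> hθA; rewrite /is_local /=; apply: ev_inj.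
rewrite !bwhiskerE !bwhisker_braid !comp_assoc; congr (_ ∘ _).
apply: (iso_epi (u := iso_comp (rwhisker_iso T (M^∨ ⊗ M) (θ A))
                        (lwhisker_iso T A (rwhisker_iso T M (θ M^∨))))).
rewrite /= -!comp_assoc -twist_mul_whisker -hθ (reassoc (dual_map_ev _)) -comp_assoc.
rewrite -bwhisker_natural (comp_assoc (e M) (_ ▸ _)) dual_actionE -!comp_assoc.
rewrite (comp_assoc (e M) (_ ▸ _)) dual_actionE -!comp_assoc.
rewrite swap_natural (reassoc (swap_natural_l _ _ _ _)) -!comp_assoc swap_natural_r.
rewrite (reassoc (lwhisker_eq T _ (erefl (act M ∘ (θ A ▷ M))))).
rewrite (reassoc (esym (whisker_exchange _ _ _))) -comp_assoc.
rewrite (reassoc (dual_map_ev _)) -!comp_assoc.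
rewrite (reassoc (lwhisker_eq T _ (erefl (θ M ∘ _)))) twist_act //.
rewrite -whisker_exchange (reassoc (rwhisker_eq T _ hθA)) rwhisker_id comp_id_l.
by rewrite lwhisker_comp -comp_assoc.
Qed.

End DualModule.

Section DualLinear.
Context (A : Algebra T) (hA : is_commutative c A).

Definition dual_module (M : Module A) : Module A :=
  Build_Module (dual_action_module M hA).

Lemma ev_balanced (M : Module A) : balanced c (M := dual_module M) (e M).
Proof. exact: dual_actionE. Qed.

(** The action on DM is defined by the requirement that e_M be balanced; so the
    two conditions compare the same pairings on A ⊗ (N ⊗ M). *)
Lemma linear_pairing (N M : Module A) (φ : hom N (dual_module M)) :
  linear_map φ <-> balanced c (e M ∘ (φ ▷ M)).
Proof.
have e1 : e M ∘ ((φ ∘ act N) ▷ M) = e M ∘ (φ ▷ M) ∘ (act N ▸ M) ∘ α A N M.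
  by rewrite rwhisker_comp bwhiskerE !comp_assoc.
have e2 : e M ∘ ((dual_action M ∘ (A ◁ φ)) ▷ M) =
          e M ∘ (φ ▷ M) ∘ ((N ◁ act M) ∘ σ A N M) ∘ α A N M.
  rewrite bwhiskerE bwhisker_pre_r !comp_assoc dual_actionE -!comp_assoc.
  rewrite (reassoc (swap_natural_r _ _ _ _)) -!comp_assoc.
  by rewrite (reassoc (esym (whisker_exchange _ _ _))) -!comp_assoc.
split=> [lφ | bφ].
  by apply: (iso_epi (u := α A N M)); rewrite -e1 -e2 lφ.
by apply: ev_inj; rewrite e1 bφ -e2.
Qed.

(** Both sides are pairings A ⊗ (M ⊗ DM) -> K that differ by the double braiding
    of A and M, which disappears in the action of M. *)
Lemma bidual_linear (M : Module A) (hM : is_local c M) :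
  linear_map (N := dual_module (dual_module M)) (bidual M).
Proof.
apply/linear_pairing; rewrite /balanced /= bidualE -!comp_assoc.
rewrite [in RHS](reassoc (braid_bwhisker_r _ _ _)) -(local_whisker hM).
rewrite -!comp_assoc (comp_assoc (e M) (_ ▸ _)) dual_actionE -!comp_assoc.
by rewrite (comp_assoc (σ A _ M)) (reassoc (esym (braid_bwhisker_l _ _ _)))
           -!comp_assoc.
Qed.

Local Notation DA := (dual_module (regular A)).

(** The composite of f with the morphism DA -> K that evaluates at the unit
    of A. *)
Definition counit (X : Module A) (f : hom X A^∨) : hom X K :=
  e A ∘ ((f ▷ A) ∘ (c A X ∘ one_ins A X)).

Lemma counit_comp (X Y : Module A) (f : hom X A^∨) (u : hom Y X) :
  counit f ∘ u = counit (f ∘ u).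
Proof.
rewrite /counit -!comp_assoc one_ins_natural (comp_assoc (c A X)).
by rewrite braid_natural_r rwhisker_comp -!comp_assoc.
Qed.

(** The pairing with A represented by a linear map takes the same value on
    b a ⊗ x and on b ⊗ a x; then take b to be the unit of A. *)
Lemma counit_act (X : Module A) (f : hom X DA) : linear_map f ->
  counit f ∘ act X = e A ∘ ((f ▷ A) ∘ c A X).
Proof.
move=> lf.
have inv : e A ∘ ((f ▷ A) ∘ (c A X ∘ (A ◁ act X))) =
           e A ∘ ((f ▷ A) ∘ (c A X ∘ (mul A ▸ X))).
  rewrite braid_bwhisker_r -(mul_swap hA) (reassoc (braid_bwhisker_l _ _ _)).
  rewrite (reassoc (linear_whisker (N := DA) A lf)) -!comp_assoc.
  rewrite (reassoc (ev_balanced (regular A))) -!comp_assoc.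
  rewrite (reassoc (swap_natural_r _ _ _ _)) -!comp_assoc.
  by rewrite (reassoc (esym (whisker_exchange _ _ _))) -!comp_assoc.
rewrite /counit -!comp_assoc one_ins_natural (comp_assoc (c A X)).
rewrite (comp_assoc (f ▷ A)) (comp_assoc (e A)) inv -!comp_assoc.
by rewrite mul_one_whisker comp_id_r.
Qed.

Lemma counit_inj (X : Module A) (f g : hom X DA) :
  linear_map f -> linear_map g -> counit f = counit g -> f = g.
Proof.
move=> lf lg fg; apply: ev_inj; apply: (iso_epi (u := c A X)).
by rewrite -!comp_assoc -!counit_act // fg.
Qed.

(** The linear map that corresponds to h represents the pairing x ⊗ a |-> h(a x).
    Linearity is checked after the braidings have moved both copies of A in
    front of X, where it is associativity of the action. *)
Lemma counit_full (X : Module A) (h : hom X K) :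
  exists f : hom X DA, linear_map f /\ counit f = h.
Proof.
pose f : hom X DA := curry D (h ∘ act X ∘ bwd (c A X)).
have fE : e A ∘ ((f ▷ A) ∘ c A X) = h ∘ act X.
  by rewrite comp_assoc [X in X ∘ _]ev_curry -comp_assoc bwd_fwd comp_id_r.
have fEk Y (k : hom Y _) : e A ∘ ((f ▷ A) ∘ (c A X ∘ k)) = h ∘ (act X ∘ k).
  by rewrite (comp_assoc h) -fE -!comp_assoc.
exists f; split; last by rewrite /counit fEk act_one comp_id_r.
apply/linear_pairing.
change (e A ∘ (f ▷ A) ∘ (act X ▸ A) =
        e A ∘ (f ▷ A) ∘ ((X ◁ mul A) ∘ σ A X A)).
apply: (iso_epi (u := iso_comp (lwhisker_iso T A (c A X)) (σ A A X))).
rewrite /= -!comp_assoc -braid_bwhisker_r fEk.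
rewrite (comp_assoc (σ A X A)) (reassoc (esym (braid_bwhisker_l _ _ _))).
by rewrite -!comp_assoc mul_swap // fEk act_mul.
Qed.

End DualLinear.

End Duality.

(** * Duality for local modules *)

Section LocalDuality.
Context (C : Category) (I : C) (T : Monoidal I) (c : Braiding T).
Context (K : C) (D : GrothendieckVerdier T K).
Context (A : Algebra T) (hA : is_commutative c A).

Local Notation "X ⊗ Y" := (tob T X Y)
  (at level 35, right associativity) : cat_scope.
Local Notation "f ⊠ g" := (thom T f g)
  (at level 35, right associativity) : cat_scope.
Local Notation "X ◁ g" := (lwhisker T X g) (at level 34, right associativity).
Local Notation "f ▷ W" := (rwhisker T f W) (at level 33, left associativity).
Local Notation "f ▸ W" := (bwhisker f W) (at level 33, left associativity).
Local Notation α := (associator T).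
Local Notation σ := (swap c).
Local Notation "X ^∨" := (dual D X) (at level 2, left associativity, format "X ^∨").
Local Notation e := (ev D).
Local Notation Loc := (local_modules A c).
Local Notation "⌊ M ⌋" := (underlying M) (format "⌊ M ⌋") : cat_scope.
Local Notation "⟦ f ⟧" := (underlying_hom f) (format "⟦ f ⟧") : cat_scope.

Hypothesis dual_local : forall M : Module A,
  is_local c M -> is_local c (dual_module D hA M).

Definition local_dual (M : Loc) : Loc :=
  exist _ (dual_module D hA ⌊M⌋) (dual_local (svalP M)).

Local Notation DA := (local_dual (regular_local_module hA)).

Context (S : RelativeTensor hA).
Local Notation "M ⊙ N" := (tob S M N) (at level 35, right associativity).
Local Notation π := (rel_proj S).

Lemma proj_balanced_tensor (M N : Loc) : is_balanced_tensor c (π M N).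
Proof. exact/balanced_tensorP/rel_coequalizer. Qed.

Lemma proj_epi (M N : Loc) : is_epi (π M N).
Proof. exact: (coequalizer_epi (proj_balanced_tensor M N)). Qed.

Lemma local_ev_sig (M : Loc) :
  {v : hom (local_dual M ⊙ M) DA | counit c ⟦v⟧ ∘ π (local_dual M) M = e ⌊M⌋}.
Proof.
have [h hE] := descend (proj_balanced_tensor (local_dual M) M) (ev_balanced D hA ⌊M⌋).
apply: constructive_indefinite_description.
have [v [lv vE]] := counit_full D hA h.
exists (local_hom (N := DA) lv); rewrite [counit _ _]vE.
exact: hE.
Qed.

Definition local_ev (M : Loc) := sval (local_ev_sig M).

Lemma local_evE (M : Loc) :
  counit c ⟦local_ev M⟧ ∘ π (local_dual M) M = e ⌊M⌋.
Proof. exact: (svalP (local_ev_sig M)). Qed.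

(** Linear maps N ⊗_A M -> DA as balanced pairings N ⊗ M -> K. *)
Definition rel_pairing (M N : Loc) (f : hom (N ⊙ M) DA) : hom (⌊N⌋ ⊗ ⌊M⌋) K :=
  counit c ⟦f⟧ ∘ π N M.

Lemma rel_pairing_balanced (M N : Loc) (f : hom (N ⊙ M) DA) : balanced c (rel_pairing f).
Proof.
by rewrite /balanced /rel_pairing -!comp_assoc (proj1 (proj_balanced_tensor N M)).
Qed.

Lemma rel_pairing_inj (M N : Loc) (f g : hom (N ⊙ M) DA) :
  rel_pairing f = rel_pairing g -> f = g.
Proof.
move=> /proj_epi fg; apply: underlying_inj.
exact: (counit_inj (underlying_linear f) (underlying_linear g) fg).
Qed.

Lemma rel_pairing_comp (M M' N N' : Loc) (f : hom (N' ⊙ M') DA)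
    (g : hom N N') (h : hom M M') :
  rel_pairing (f ∘ thom S g h) = rel_pairing f ∘ (⟦g⟧ ⊠ ⟦h⟧).
Proof.
by rewrite /rel_pairing underlying_comp -counit_comp -!comp_assoc rel_hom.
Qed.

Lemma rel_pairing_ev (M N : Loc) (φ : hom N (local_dual M)) :
  rel_pairing (local_ev M ∘ thom S φ (idm M)) = e ⌊M⌋ ∘ (⟦φ⟧ ▷ ⌊M⌋).
Proof. by rewrite rel_pairing_comp [rel_pairing _]local_evE. Qed.

Lemma local_curry_linear (M N : Loc) (f : hom (N ⊙ M) DA) :
  linear_map (M := ⌊N⌋) (N := dual_module D hA ⌊M⌋) (curry D (rel_pairing f)).
Proof.
by apply/linear_pairing; rewrite [_ ∘ _]ev_curry; apply: rel_pairing_balanced.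
Qed.

Definition local_curry (M N : Loc) (f : hom (N ⊙ M) DA) : hom N (local_dual M) :=
  local_hom (N := local_dual M) (local_curry_linear f).

Definition local_duals : Duals S DA.
Proof.
exists local_dual local_ev local_curry.
- move=> M N f; apply: rel_pairing_inj; rewrite rel_pairing_ev.
  exact: ev_curry.
- move=> M N f φ <-; apply: underlying_inj; rewrite [RHS]/underlying_hom /=.
  by rewrite rel_pairing_ev; apply: curry_unique.
Defined.

(** Duals of morphisms are computed in C; so naturality of [bidual] and the
    ribbon condition carry over. *)
Lemma local_dual_map (M N : Loc) (f : hom M N) :
  ⟦dual_map local_duals f⟧ = dual_map D ⟦f⟧.
Proof.
rewrite [LHS]/underlying_hom /=; congr (curry D _).
by rewrite rel_pairing_comp [rel_pairing _]local_evE.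
Qed.

Definition local_bidual (M : Loc) : Iso M (local_dual (local_dual M)) :=
  local_iso (M := M) (N := local_dual (local_dual M)) (u := bidual_iso c D ⌊M⌋)
    (bidual_linear D hA (svalP M)).

Lemma local_bidual_natural (M N : Loc) (f : hom M N) :
  local_bidual N ∘ f = dual_map local_duals (dual_map local_duals f) ∘ local_bidual M.
Proof.
apply: underlying_inj; rewrite !underlying_comp !local_dual_map.
exact: bidual_natural.
Qed.

Definition op_iso (E : Category) (X Y : E) (u : Iso X Y) : @Iso (op E) Y X :=
  @Build_Iso (op E) Y X u (bwd u) (fwd_bwd u) (bwd_fwd u).

Definition op_dualizing_functor : Functor Loc (op Loc) :=
  @Build_Functor Loc (op Loc) local_dual (fun X Y f => dual_map local_duals f)
    (dual_map_id local_duals) (fun X Y Z g f => dual_map_comp local_duals g f).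

Lemma local_duals_equivalence : is_equivalence (dualizing_functor local_duals).
Proof.
exists op_dualizing_functor; split; constructor.
- exists (fun M : op Loc => op_iso (local_bidual M)) => M N f /=.
  exact: (esym (local_bidual_natural f)).
- exists (fun M : Loc => iso_inv (local_bidual M)) => M N f /=.
  have nat : bwd (local_bidual N) ∘ dual_map local_duals (dual_map local_duals f) =
             f ∘ bwd (local_bidual M).
    apply: (iso_mono (u := local_bidual N)); rewrite fwdK comp_assoc.
    by rewrite local_bidual_natural -comp_assoc fwd_bwd comp_id_r.
  exact: nat.
Qed.

Definition local_gv : GrothendieckVerdier S DA :=
  Build_GrothendieckVerdier local_duals_equivalence.

Context (θ : Twist c) (hθ : is_ribbon D θ) (hθA : (θ A : hom A A) = idm A).

Lemma twist_linear (M : Loc) : linear_map (M := ⌊M⌋) (N := ⌊M⌋) (θ ⌊M⌋).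
Proof.
rewrite /linear_map -[act _]comp_id_r (twist_act _ (svalP M)) hθA.
by rewrite rwhisker_id comp_id_l !comp_id_r.
Qed.

Definition local_twist : Twist (rel_braiding S).
Proof.
exists (fun M : Loc => local_iso (twist_linear M)).
- by move=> M N f; apply: underlying_inj; apply: twist_natural.
- move=> M N; apply: underlying_inj; apply: (proj_epi (M := M) (N := N)).
  rewrite [LHS]twist_natural twist_tensor !underlying_comp -!comp_assoc.
  rewrite rel_hom (reassoc (rel_braid _ _ _)) -comp_assoc.
  by rewrite (reassoc (rel_braid _ _ _)) -!comp_assoc.
Defined.

Lemma local_twist_ribbon : is_ribbon local_gv local_twist.
Proof. by move=> M; apply: underlying_inj; rewrite local_dual_map; apply: hθ. Qed.

End LocalDuality.

(** A coequalizer is a cokernel of the difference. *)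
Lemma abelian_coequalizers (k : fieldType) (C : LinearCategory k) (hC : is_abelian C)
    (X Y : C) (f g : hom X Y) : exists (Q : C) (q : hom Y Q), is_coequalizer f g q.
Proof.
have [Q [q [q0 U]]] := abelian_cokernel hC (hadd (hscale (-1) g) f).
have compE Z (h : hom Y Z) : h ∘ hadd (hscale (-1) g) f = hzero X Z <-> h ∘ f = h ∘ g.
  have -> : h ∘ hadd (hscale (-1) g) f = hadd (hscale (-1) (h ∘ g)) (h ∘ f).
    exact: lcomp_linear_r.
  rewrite /hadd /hscale /hzero GRing.scaleN1r; split=> [E | ->].
    by apply/eqP; rewrite -GRing.subr_eq0 GRing.addrC; apply/eqP.
  by rewrite GRing.addNr.
exists Q, q; split; first exact/compE.
by move=> Z h /compE; apply: U.
Qed.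

Theorem theorem1p5 (k : fieldType) (C : LinearCategory k) (hC : is_abelian C)
    (I : C) (T : Monoidal I) (hT : is_bilinear_tensor T) (c : Braiding T)
    (K : C) (D : GrothendieckVerdier T K)
    (theta : Twist c) (htheta : is_ribbon D theta)
    (A : Algebra T) (hA : is_commutative c A)
    (hthetaA : theta A ∘ theta A = idm A) :
  exists (hDA : is_module (dual_act A c D))
         (hDAloc : is_local c (Build_Module hDA)),
    let DA : local_modules A c := exist _ (Build_Module hDA) hDAloc in
    inhabited (RelativeTensor hA) /\
    forall S : RelativeTensor hA,
      exists DS : GrothendieckVerdier S DA,
        (theta A : hom A A) = idm A ->
        exists thetaS : Twist (rel_braiding S),
          (forall M : local_modules A c,
             underlying_hom (thetaS M) = theta (underlying M)) /\
          is_ribbon DS thetaS.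
Proof.
have dual_local M : is_local c M -> is_local c (dual_module D hA M).
  by move=> hM; apply: dual_action_local htheta _ hM hthetaA.
exists (dual_action_module D (regular A) hA),
  (dual_local _ (svalP (regular_local_module hA))).
split.
  apply: relative_tensor_exists; last exact: abelian_coequalizers.
  exact: (gv_tensor_coequalizer c D).
move=> S; exists (local_gv dual_local S) => hthetaA1.
exists (local_twist S hthetaA1); split=> //.
exact: local_twist_ribbon.
Qed.
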